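(* Let $X_0$ be a smooth, embedded, closed curve in the plane. If Gage's area-preserving flow with initial curve $X_0$ does not blow up on the time interval $[0,+\infty)$ (i.e. the evolving curve is smooth for all $t\ge0$), then the evolving curve converges to a circle of finite radius as $t\to\infty$.
   Context: Gage's area-preserving flow: $\frac{\partial X}{\partial t}=\left(\kappa-\frac{2\pi}{L}\right)N$, $X(\cdot,0)=X_0$, where $\kappa$ is the curvature, $N$ the inward unit normal, $L=L(t)$ the length of $X(\cdot,t)$. *)

(* Defs.v *)
From Stdlib Require Import Reals.
From Coquelicot Require Import Coquelicot.
Open Scope R_scope.

Definition smooth1 (g : R -> R) : Prop :=
  forall (n : nat) (u : R), ex_derive (Derive_n g n) u.

Definition pd_t (f : R -> R -> R) : R -> R -> R :=
  fun t u => Derive (fun s => f s u) t.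
Definition pd_u (f : R -> R -> R) : R -> R -> R :=
  fun t u => Derive (fun v => f t v) u.

Fixpoint iter_pd (w : list bool) (f : R -> R -> R) : R -> R -> R :=
  match w with
  | nil => f
  | cons b w' => (if b then pd_t else pd_u) (iter_pd w' f)
  end.

Definition smooth2 (f : R -> R -> R) : Prop :=
  forall (w : list bool) (t u : R),
    ex_derive (fun s => iter_pd w f s u) t /\
    ex_derive (fun v => iter_pd w f t v) u /\
    continuous (fun p : R * R => iter_pd w f (fst p) (snd p)) (t, u).

Definition periodic1 (a : R -> R) : Prop := forall u, a (u + 1) = a u.

Definition speed (a b : R -> R) (u : R) : R :=
  sqrt (Derive a u ^ 2 + Derive b u ^ 2).

Definition regular (a b : R -> R) : Prop := forall u, 0 < speed a b u.

Definition simple_closed (a b : R -> R) : Prop :=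
  forall u v, 0 <= u < 1 -> 0 <= v < 1 -> a u = a v -> b u = b v -> u = v.

Definition length (a b : R -> R) : R :=
  RInt (fun u => speed a b u) 0 1.

(* Signed enclosed area (positive iff counterclockwise orientation). *)
Definition signed_area (a b : R -> R) : R :=
  / 2 * RInt (fun u => a u * Derive b u - b u * Derive a u) 0 1.

Definition orient (a b : R -> R) : R :=
  if Rlt_dec 0 (signed_area a b) then 1 else -1.

(* Inward unit normal N = orient * J(T), J = rotation by +pi/2. *)
Definition inward_normal_x (a b : R -> R) (u : R) : R :=
  orient a b * (- Derive b u) / speed a b u.
Definition inward_normal_y (a b : R -> R) (u : R) : R :=
  orient a b * Derive a u / speed a b u.

(* Curvature kappa w.r.t. the inward normal (so that kappa N = X_ss). *)
Definition curvature (a b : R -> R) (u : R) : R :=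
  orient a b *
  (Derive a u * Derive_n b 2 u - Derive b u * Derive_n a 2 u)
  / (speed a b u ^ 3).

(* (x, y) : R -> R -> R, (t, u) |-> X(u, t), is a solution of
     dX/dt = (kappa - 2 pi / L) N,   X(., 0) = X0 = (x0, y0)
   which is smooth on [0, +oo) x S^1 (i.e. does not blow up on [0,+oo)).
   Smoothness up to the boundary t = 0 is expressed as x, y being restrictions
   to t >= 0 of C^infinity functions on R x R (equivalent by Seeley's
   extension theorem); values at t < 0 are irrelevant. *)
Definition gage_flow_global (x0 y0 : R -> R) (x y : R -> R -> R) : Prop :=
  smooth2 x /\ smooth2 y /\
  (forall u, x 0 u = x0 u /\ y 0 u = y0 u) /\
  (forall t, 0 <= t -> periodic1 (x t) /\ periodic1 (y t)) /\
  (forall t, 0 <= t -> regular (x t) (y t)) /\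
  (forall t u, 0 <= t ->
     pd_t x t u =
       (curvature (x t) (y t) u - 2 * PI / length (x t) (y t))
       * inward_normal_x (x t) (y t) u /\
     pd_t y t u =
       (curvature (x t) (y t) u - 2 * PI / length (x t) (y t))
       * inward_normal_y (x t) (y t) u).

Definition dist2 (p1 p2 q1 q2 : R) : R :=
  sqrt ((p1 - q1) ^ 2 + (p2 - q2) ^ 2).

(* The curves u |-> (x t u, y t u) converge as t -> +oo, in Hausdorff
   distance, to the circle of center (c1, c2) and radius r. *)
Definition converges_to_circle (x y : R -> R -> R) (c1 c2 r : R) : Prop :=
  forall eps : R, 0 < eps -> exists T : R, forall t : R, T <= t ->
    (forall u, Rabs (dist2 (x t u) (y t u) c1 c2 - r) < eps) /\
    (forall th : R, exists u : R,
        dist2 (x t u) (y t u) (c1 + r * cos th) (c2 + r * sin th) < eps).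

(* Main.v *)
(* No topology of the curve is used, only the existence for all time.  Let [L]
   be the length, [S] the signed area, [s = +-1] its orientation, [2 pi k] the
   total curvature and [V = kappa - 2 pi / L] the normal speed.  Then
   [S' = 2 pi (s - k)], so that continuity in time makes [s] and [k] constant;
   since [L] does not increase and [4 pi |S| <= L^2], global existence forces
   [k = s], so the area [s S] is preserved and [L' = - int V^2].
   With [c] the centre of mass and [Y = T - (2 pi / L) s i (X - c)], Wirtinger's
   inequality reads [int |Y|^2 <= 2 D / L], where [D = L^2 - 4 pi s S].  It
   implies at once that [X] is within a multiple of [sqrt D] of a circle of
   centre [c] and radius [L / 2 pi], and that [D <= C L^3 int V^2].  Hence
   [D' = - 2 L int V^2 <= - a D]: [D] decays exponentially, and then the speed
   of [c] is integrable in time.  The area is nonzero, for otherwise [D = L^2]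
   and the last inequality makes [L] vanish in finite time. *)
Require Import Defs.
From Stdlib Require Import Reals.
From Coquelicot Require Import Coquelicot.
From Stdlib Require Import ZArith Lra Lia ClassicalEpsilon Ranalysis5.
Open Scope R_scope.

(** * Continuity and integration *)

(** The orientation entering the flow is a sign test on the area, so it is not known in advance to
    vary continuously in time; its constancy is read off from [int (x_t y_u - y_t x_u)], which is
    continuous and takes values in [2 PI Z]. The field [Y] vanishes on a circle of centre [c]
    traversed in the direction [s], since the unit tangent is then [2 pi / L] times the radius
    vector turned by a quarter; this is why its square integral is tied to the deficit [D].
    Wirtinger's inequality is proved with the speed as density, so that no curve has to be
    reparametrised by arc length. No pointwise bound on the curvature is derived. The speed of [c]
    is controlled by the square root of [int V^2], whose integrability in time comes from that of
    [int V^2] against a growing exponential; for this reason only half of the available decay rate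
    of [D] is spent. At negative times the extended maps satisfy neither the equation nor
    regularity. Time derivatives are therefore taken at [t > 0], and the estimates start at time
    1. *)

Section Continuity.
Context {U : UniformSpace}.
Implicit Types (f g : U -> R) (z : U).

Lemma continuous_Rplus f g z :
  continuous f z -> continuous g z -> continuous (fun p => f p + g p) z.
Proof. intros Hf Hg; exact (continuous_plus f g z Hf Hg). Qed.

Lemma continuous_Rminus f g z :
  continuous f z -> continuous g z -> continuous (fun p => f p - g p) z.
Proof. intros Hf Hg; exact (continuous_minus f g z Hf Hg). Qed.

Lemma continuous_Ropp f z : continuous f z -> continuous (fun p => - f p) z.
Proof. intros Hf; exact (continuous_opp f z Hf). Qed.

Lemma continuous_Rmult f g z :
  continuous f z -> continuous g z -> continuous (fun p => f p * g p) z.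
Proof. intros Hf Hg; exact (continuous_mult f g z Hf Hg). Qed.

Lemma continuous_after (h : R -> R) f z :
  continuous f z -> continuous h (f z) -> continuous (fun p => h (f p)) z.
Proof. intros Hf Hh; exact (continuous_comp f h z Hf Hh). Qed.

Lemma continuous_Rdiv f g z :
  continuous f z -> continuous g z -> g z <> 0 ->
  continuous (fun p => f p / g p) z.
Proof.
intros Hf Hg H0; apply continuous_Rmult; [exact Hf|].
apply (continuous_after Rinv); [exact Hg | now apply continuous_Rinv].
Qed.

Lemma continuous_Rpow f n z :
  continuous f z -> continuous (fun p => f p ^ n) z.
Proof.
intros Hf; induction n as [|n IH]; simpl.
- apply continuous_const.
- now apply continuous_Rmult.
Qed.

End Continuity.

Definition cont (f : R -> R) : Prop := forall u, continuous f u.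

Lemma is_derive_cont (f df : R -> R) :
  (forall u, is_derive f u (df u)) -> cont f.
Proof. intros H u; apply (ex_derive_continuous (V := R_NormedModule) f u).
now exists (df u). Qed.

Ltac cnt :=
  lazymatch goal with
  | |- cont _ => let u := fresh "u" in intros u; cnt
  | |- continuous (fun _ => ?c) _ => apply continuous_const
  | |- continuous (fun p => p) _ => apply continuous_id
  | |- continuous (fun p => _ + _) _ => apply continuous_Rplus; cnt
  | |- continuous (fun p => _ - _) _ => apply continuous_Rminus; cnt
  | |- continuous (fun p => _ * _) _ => apply continuous_Rmult; cnt
  | |- continuous (fun p => - _) _ => apply continuous_Ropp; cnt
  | |- continuous (fun p => _ / _) _ => apply continuous_Rdiv; [cnt | cnt | try first [solve [auto] | solve [apply Rgt_not_eq; red; auto]]]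
  | |- continuous (fun p => _ ^ _) _ => apply continuous_Rpow; cnt
  | |- continuous (fun p => cos _) _ =>
      apply (continuous_after cos); [cnt | apply continuous_cos]
  | |- continuous (fun p => sin _) _ =>
      apply (continuous_after sin); [cnt | apply continuous_sin]
  | |- continuous (fun p => sqrt _) _ =>
      apply (continuous_after sqrt); [cnt | apply continuous_sqrt]
  | |- continuous (fun p => Rabs _) _ =>
      apply (continuous_after Rabs); [cnt | apply continuous_Rabs]
  | |- _ => auto
  end.

Lemma cont_ex_RInt f a b : cont f -> ex_RInt f a b.
Proof. intros Hf; apply (@ex_RInt_continuous R_CompleteNormedModule); auto. Qed.

Lemma int_plus f g a b : cont f -> cont g ->
  RInt (fun u => f u + g u) a b = RInt f a b + RInt g a b.
Proof. intros Hf Hg; apply (RInt_plus f g); now apply cont_ex_RInt. Qed.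

Lemma int_minus f g a b : cont f -> cont g ->
  RInt (fun u => f u - g u) a b = RInt f a b - RInt g a b.
Proof. intros Hf Hg; apply (RInt_minus f g); now apply cont_ex_RInt. Qed.

Lemma int_scal c f a b : cont f ->
  RInt (fun u => c * f u) a b = c * RInt f a b.
Proof. intros Hf; apply (RInt_scal f a b c); now apply cont_ex_RInt. Qed.

Lemma int_ext (f g : R -> R) a b : (forall u, f u = g u) ->
  RInt f a b = RInt g a b.
Proof. intros H; apply RInt_ext; auto. Qed.

Lemma int_le f g a b : a <= b -> cont f -> cont g ->
  (forall u, f u <= g u) -> RInt f a b <= RInt g a b.
Proof. intros Hab Hf Hg H; apply RInt_le; auto; now apply cont_ex_RInt. Qed.

Lemma int_ge0 f a b : a <= b -> cont f -> (forall u, 0 <= f u) ->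
  0 <= RInt f a b.
Proof.
intros Hab Hf H.
replace 0 with (RInt (fun _ => 0) a b).
- apply int_le; auto; cnt.
- rewrite RInt_const; unfold scal; simpl; unfold mult; simpl; ring.
Qed.

Lemma int_abs_le f a b : a <= b -> cont f ->
  Rabs (RInt f a b) <= RInt (fun u => Rabs (f u)) a b.
Proof. intros Hab Hf; apply abs_RInt_le; auto; now apply cont_ex_RInt. Qed.

Lemma int_Chasles f a b c : cont f ->
  RInt f a b + RInt f b c = RInt f a c.
Proof. intros Hf; apply (RInt_Chasles f); now apply cont_ex_RInt. Qed.

Lemma int_derive (F f : R -> R) a b :
  (forall u, is_derive F u (f u)) -> cont f -> RInt f a b = F b - F a.
Proof.
intros HF Hf; apply is_RInt_unique, (is_RInt_derive F f); auto.
Qed.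

Lemma is_derive_int f a u : cont f ->
  is_derive (fun s => RInt f a s) u (f u).
Proof.
intros Hf; apply (is_derive_RInt f _ a u); auto.
exists (mkposreal 1 Rlt_0_1); intros s _.
apply (RInt_correct f), cont_ex_RInt; exact Hf.
Qed.

Lemma int_periodic f a : cont f -> periodic1 f ->
  RInt f a (a + 1) = RInt f 0 1.
Proof.
intros Hf Hp.
assert (E : RInt f 1 (a + 1) = RInt f 0 a).
{ pose proof (RInt_comp_lin f 1 1 0 a) as H.
  replace (1 * 0 + 1) with 1 in H by ring.
  replace (1 * a + 1) with (a + 1) in H by ring.
  rewrite <- H by (apply cont_ex_RInt; exact Hf).
  apply int_ext; intros u; unfold scal; simpl; unfold mult; simpl.
  replace (1 * u + 1) with (u + 1) by ring; rewrite Hp; ring. }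
pose proof (int_Chasles f a 0 1 Hf) as H1.
pose proof (int_Chasles f 0 a 0 Hf) as H2.
rewrite RInt_point in H2; change (@zero R_CompleteNormedModule) with 0 in H2.
pose proof (int_Chasles f a 1 (a + 1) Hf) as H3.
lra.
Qed.

(* Integrate [g^2 - 2 c g f + c^2 f^2 >= 0] and optimise over [c]. *)
Lemma int_Cauchy_Schwarz f g a b : a <= b -> cont f -> cont g ->
  RInt (fun u => f u * g u) a b ^ 2
  <= RInt (fun u => f u ^ 2) a b * RInt (fun u => g u ^ 2) a b.
Proof.
intros Hab Hf Hg.
set (A := RInt (fun u => f u ^ 2) a b).
set (B := RInt (fun u => f u * g u) a b).
set (C := RInt (fun u => g u ^ 2) a b).
assert (Q : forall c, 0 <= C - 2 * c * B + c ^ 2 * A).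
{ intros c.
  replace (C - 2 * c * B + c ^ 2 * A)
    with (RInt (fun u => (g u - c * f u) ^ 2) a b).
  - apply int_ge0; auto; [cnt|]. intros u; apply pow2_ge_0.
  - rewrite (int_ext _ (fun u => g u ^ 2 - (2 * c) * (f u * g u)
        + c ^ 2 * f u ^ 2)) by (intros u; ring).
    rewrite int_plus, int_minus, !int_scal by cnt. reflexivity. }
assert (HA : 0 <= A).
{ apply int_ge0; auto; [cnt|]. intros u; apply pow2_ge_0. }
destruct (Req_dec A 0) as [E|E].
- rewrite E, Rmult_0_l.
  destruct (Req_dec B 0) as [->|HB]; [lra|].
  (* With [A = 0] the quadratic is affine in [c]; this value of [c] makes it [-1]. *)
  specialize (Q ((C + 1) / (2 * B))). rewrite E in Q.
  replace (C - 2 * ((C + 1) / (2 * B)) * B + ((C + 1) / (2 * B)) ^ 2 * 0)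
    with (-1) in Q by (field; exact HB). lra.
- specialize (Q (B / A)).
  replace (C - 2 * (B / A) * B + (B / A) ^ 2 * A)
    with ((A * C - B ^ 2) / A) in Q by (field; exact E).
  assert (0 < A) by lra.
  assert (0 <= ((A * C - B ^ 2) / A) * A) by (apply Rmult_le_pos; lra).
  replace (((A * C - B ^ 2) / A) * A) with (A * C - B ^ 2) in * by (field; lra).
  lra.
Qed.

(** * Differentiation *)

Section Derivation.
Variables (f g : R -> R) (u a b : R).
Hypotheses (Hf : is_derive f u a) (Hg : is_derive g u b).

Lemma is_derive_Rplus : is_derive (fun s => f s + g s) u (a + b).
Proof. exact (is_derive_plus f g u a b Hf Hg). Qed.

Lemma is_derive_Rminus : is_derive (fun s => f s - g s) u (a - b).
Proof. exact (is_derive_minus f g u a b Hf Hg). Qed.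

Lemma is_derive_Ropp : is_derive (fun s => - f s) u (- a).
Proof. exact (is_derive_opp f u a Hf). Qed.

Lemma is_derive_Rmult : is_derive (fun s => f s * g s) u (a * g u + f u * b).
Proof. exact (is_derive_mult f g u a b Hf Hg Rmult_comm). Qed.

Lemma is_derive_Rdiv : g u <> 0 ->
  is_derive (fun s => f s / g s) u ((a * g u - f u * b) / g u ^ 2).
Proof. intros H; exact (is_derive_div f g u a b Hf Hg H). Qed.

Lemma is_derive_Rpow n :
  is_derive (fun s => f s ^ n) u (INR n * a * f u ^ (pred n)).
Proof. exact (is_derive_pow f n u a Hf). Qed.

Lemma is_derive_after (h : R -> R) c : is_derive h (f u) c ->
  is_derive (fun s => h (f s)) u (a * c).
Proof. intros Hh; exact (is_derive_comp h f u c a Hh Hf). Qed.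

End Derivation.

Lemma is_derive_sqrt_pos x : 0 < x -> is_derive sqrt x (/ (2 * sqrt x)).
Proof.
intros Hx; apply is_derive_Reals.
now apply derivable_pt_lim_sqrt.
Qed.

Lemma is_derive_Rconst (c u : R) : is_derive (fun _ : R => c) u 0.
Proof. exact (is_derive_const c u). Qed.

Lemma is_derive_Rid (u : R) : is_derive (fun s : R => s) u 1.
Proof. exact (is_derive_id u). Qed.

Lemma is_derive_value (f : R -> R) (u a b : R) : is_derive f u a -> a = b -> is_derive f u b.
Proof. now intros H <-. Qed.

Ltac der :=
  lazymatch goal with
  | |- is_derive (fun _ => ?c) _ _ => apply is_derive_Rconst
  | |- is_derive (fun p => p) _ _ => apply is_derive_Rid
  | |- is_derive (fun p => _ + _) _ _ => apply is_derive_Rplus; der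
  | |- is_derive (fun p => _ - _) _ _ => apply is_derive_Rminus; der
  | |- is_derive (fun p => _ * _) _ _ => apply is_derive_Rmult; der
  | |- is_derive (fun p => - _) _ _ => apply is_derive_Ropp; der
  | |- is_derive (fun p => _ / _) _ _ => apply is_derive_Rdiv; [der | der | try lra]
  | |- is_derive (fun p => _ ^ _) _ _ => apply is_derive_Rpow; der
  | |- is_derive (fun p => cos _) _ _ =>
      eapply is_derive_after; [der | apply is_derive_cos]
  | |- is_derive (fun p => sin _) _ _ =>
      eapply is_derive_after; [der | apply is_derive_sin]
  | |- is_derive (fun p => exp _) _ _ =>
      eapply is_derive_after; [der | apply is_derive_exp]
  | |- is_derive (fun p => sqrt _) _ _ =>
      eapply is_derive_after; [der | apply is_derive_sqrt_pos]
  | |- is_derive (fun p => tan _) _ _ =>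
      eapply is_derive_after; [der | apply is_derive_tan]
  | |- _ => eauto
  end.
(** [der] builds the derivative through existential variables; comparing it with the announced one
    leaves an algebraic identity, after the side conditions. *)
Ltac derive_by := eapply is_derive_value; [der | ]; cbv beta; simpl INR; simpl pred.

(* Coquelicot types the value of [RInt f a b] in [R_CompleteNormedModule], where
   [ring] and [field] do not recognise the equality of [R]. *)
Ltac eq_R := match goal with |- @eq _ ?a ?b => change (@eq R a b) end.
Ltac ring_R := eq_R; ring.
Ltac field_R := eq_R; field.

(** * Wirtinger's inequality with respect to a density *)

Section Wirtinger.
Variable v : R -> R.
Hypothesis v_pos : forall u, 0 < v u.
Hypothesis v_cont : cont v.

Let S (u : R) : R := RInt v 0 u.

Lemma arc_derive u : is_derive S u (v u).
Proof. now apply is_derive_int. Qed.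

Lemma arc_diff p q : S q - S p = RInt v p q.
Proof. unfold S; rewrite <- (int_Chasles v 0 p q v_cont); ring. Qed.

Lemma arc_le p q : p <= q -> S p <= S q.
Proof.
intros H; pose proof (arc_diff p q).
assert (0 <= RInt v p q) by
  (apply int_ge0; auto; intros u; now apply Rlt_le).
lra.
Qed.

Lemma arc_lt p q : p < q -> S p < S q.
Proof.
intros H; pose proof (arc_diff p q).
assert (0 < RInt v p q) by (apply RInt_gt_0; auto).
lra.
Qed.

(* [F = w tan (w (S - m)) g^2], with [m] the midpoint value of [S], is regular
   on [p, q] because [w (S q - S p) < pi], vanishes at both ends, and
   [g'^2/v - w^2 g^2 v + F'] is the square of [g' + w tan (w (S - m)) g v]
   divided by [v]. *)
Lemma Dirichlet_ineq_lt (g dg : R -> R) p q w :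
  p <= q -> (forall u, is_derive g u (dg u)) -> cont dg ->
  g p = 0 -> g q = 0 -> 0 < w -> w * (S q - S p) < PI ->
  w ^ 2 * RInt (fun u => g u ^ 2 * v u) p q
  <= RInt (fun u => dg u ^ 2 / v u) p q.
Proof.
intros Hpq Hg Hdg Hp Hq Hw HPI.
assert (g_cont : cont g) by now apply (is_derive_cont g dg).
set (th := fun u => w * (S u - (S p + S q) / 2)).
assert (Hth : forall u, is_derive th u (w * v u)).
{ intros u; unfold th.
  derive_by; [apply arc_derive|].
  field. }
assert (th_cont : cont th) by (apply (is_derive_cont th _ Hth)).
assert (Hcos : forall u, p <= u <= q -> cos (th u) <> 0).
{ intros u Hu; apply Rgt_not_eq, cos_gt_0; unfold th;
  pose proof (arc_le p u (proj1 Hu)); pose proof (arc_le u q (proj2 Hu)); nra. }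
set (F := fun u => w * tan (th u) * g u ^ 2).
set (dF := fun u => w * ((tan (th u) ^ 2 + 1) * (w * v u)) * g u ^ 2
                    + w * tan (th u) * (2 * g u * dg u)).
assert (HF : forall u, p <= u <= q -> is_derive F u (dF u)).
{ intros u Hu.
  assert (Ht : is_derive (fun s => tan (th s)) u
                 ((tan (th u) ^ 2 + 1) * (w * v u))).
  { derive_by; [auto|ring]. }
  unfold F, dF; derive_by; [auto|]. field. }
assert (HdF : forall u, p <= u <= q -> continuous dF u).
{ intros u Hu.
  assert (continuous (fun s => tan (th s)) u).
  { apply (continuous_after tan); [apply th_cont|].
    apply (ex_derive_continuous (V := R_NormedModule) tan).
    eexists; apply is_derive_tan; auto. }
  unfold dF; cnt. }
assert (HI : is_RInt dF p q (minus (F q) (F p))).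
{ apply (is_RInt_derive F dF); intros u;
  rewrite Rmin_left, Rmax_right by lra; auto. }
replace (minus (F q) (F p)) with 0 in HI
  by (unfold minus, plus, opp, F; simpl; rewrite Hp, Hq; ring).
assert (C1 : cont (fun u => g u ^ 2 * v u)) by cnt.
assert (C2 : cont (fun u => dg u ^ 2 / v u))
  by cnt.
enough (RInt (fun u => w ^ 2 * (g u ^ 2 * v u) - dg u ^ 2 / v u) p q <= 0) as H.
{ rewrite int_minus, int_scal in H by (auto; cnt). lra. }
apply (is_RInt_le (fun u => w ^ 2 * (g u ^ 2 * v u) - dg u ^ 2 / v u) dF p q);
  auto.
{ apply (RInt_correct (V := R_CompleteNormedModule)), cont_ex_RInt; cnt. }
intros u _.
  assert (0 <= (dg u + w * tan (th u) * v u * g u) ^ 2 / v u).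
  { apply Rmult_le_pos; [apply pow2_ge_0|].
    apply Rlt_le, Rinv_0_lt_compat, v_pos. }
  replace ((dg u + w * tan (th u) * v u * g u) ^ 2 / v u)
    with (dF u - (w ^ 2 * (g u ^ 2 * v u) - dg u ^ 2 / v u)) in *
    by (unfold dF; field; apply Rgt_not_eq, v_pos).
  lra.
Qed.

(** The critical case [w * (S q - S p) = PI], where the tangent blows up at the ends, is the one met
    on the two halves of a closed curve. It is reached by letting [d] tend to 0 in the frequency
    [w * (1 - d)]. *)
Lemma Dirichlet_ineq (g dg : R -> R) p q w :
  p <= q -> (forall u, is_derive g u (dg u)) -> cont dg ->
  g p = 0 -> g q = 0 -> 0 < w -> w * (S q - S p) <= PI ->
  w ^ 2 * RInt (fun u => g u ^ 2 * v u) p q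
  <= RInt (fun u => dg u ^ 2 / v u) p q.
Proof.
intros Hpq Hg Hdg Hp Hq Hw HPI.
assert (g_cont : cont g) by now apply (is_derive_cont g dg).
assert (HI : 0 <= RInt (fun u => g u ^ 2 * v u) p q).
{ apply int_ge0; auto; [cnt|]. intros u.
  apply Rmult_le_pos; [apply pow2_ge_0|apply Rlt_le, v_pos]. }
set (I := RInt (fun u => g u ^ 2 * v u) p q) in *.
set (J := RInt (fun u => dg u ^ 2 / v u) p q).
assert (HS : 0 <= S q - S p) by (pose proof (arc_le p q Hpq); lra).
assert (H : forall d, 0 < d < 1 -> (w * (1 - d)) ^ 2 * I <= J).
{ intros d Hd; apply Dirichlet_ineq_lt; auto; [nra|].
  pose proof PI_RGT_0.
  destruct (Req_dec (S q - S p) 0) as [->|]; [lra|].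
  assert (0 < w * (S q - S p)) by (apply Rmult_lt_0_compat; lra). nra. }
apply le_epsilon; intros e He.
pose proof (pow2_ge_0 w).
assert (Hm : 0 <= w ^ 2 * I) by (apply Rmult_le_pos; auto).
(* Chosen so that [2 * d * (w ^ 2 * I) <= e], which bounds the loss caused by replacing [w] with
   [w * (1 - d)]. *)
set (d := e / (e + 2 * (w ^ 2 * I) + 1)).
assert (Hd : 0 < d < 1).
{ unfold d; split; [apply Rdiv_lt_0_compat; lra|].
  apply (Rmult_lt_reg_r (e + 2 * (w ^ 2 * I) + 1)); [lra|].
  unfold Rdiv; rewrite Rmult_assoc, Rinv_l; lra. }
specialize (H d Hd).
assert (d * (e + 2 * (w ^ 2 * I) + 1) = e) by (unfold d; field; lra).
assert (0 <= d ^ 2 * (w ^ 2 * I)) by (apply Rmult_le_pos; [apply pow2_ge_0|auto]).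
nra.
Qed.

End Wirtinger.

Section PeriodicWirtinger.
Variable v : R -> R.
Hypothesis v_pos : forall u, 0 < v u.
Hypothesis v_cont : cont v.
Hypothesis v_per : periodic1 v.

Let S (u : R) : R := RInt v 0 u.
Let L : R := RInt v 0 1.

Let S_lt p q : p < q -> S p < S q.
Proof. exact (arc_lt v v_pos v_cont p q). Qed.

Let S_le p q : p <= q -> S p <= S q.
Proof. exact (arc_le v v_pos v_cont p q). Qed.

Lemma arc_period u : S (u + 1) = S u + L.
Proof.
unfold S; rewrite <- (int_Chasles v 0 u (u + 1) v_cont).
now rewrite int_periodic.
Qed.

Lemma arc_total_pos : 0 < L.
Proof.
pose proof (S_lt 0 1 Rlt_0_1) as H.
unfold S in H; rewrite RInt_point in H; exact H.
Qed.

Lemma arc_INR n : S (INR n) = INR n * L /\ S (- INR n) = - (INR n * L).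
Proof.
induction n as [|n [IH1 IH2]].
- simpl; rewrite Ropp_0, Rmult_0_l, Ropp_0; unfold S; rewrite RInt_point; auto.
- rewrite S_INR; split.
  + rewrite arc_period, IH1; ring.
  + pose proof (arc_period (- (INR n + 1))) as H.
    replace (- (INR n + 1) + 1) with (- INR n) in H by ring.
    rewrite IH2 in H; lra.
Qed.

Lemma arc_surj s : exists u, S u = s.
Proof.
pose proof arc_total_pos as HL.
destruct (INR_archimed L (Rabs s) HL) as [n Hn].
destruct (arc_INR n) as [H1 H2].
pose proof (Rle_abs s); pose proof (Rle_abs (- s)); rewrite Rabs_Ropp in *.
destruct (IVT_gen S (- INR n) (INR n) s) as [u [_ Hu]].
- intros u; apply continuity_pt_filterlim.
  apply (is_derive_cont S v), arc_derive; auto.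
- rewrite H1, H2.
  assert (0 <= INR n * L) by (apply Rmult_le_pos; [apply pos_INR|lra]).
  rewrite Rmin_left, Rmax_right by lra; lra.
- now exists u.
Qed.

(** Choice picks preimages; continuity then follows from monotonicity alone, since
    [S (T s - eps) < s < S (T s + eps)] yields an admissible radius around [s]. *)
Lemma arc_inverse : exists T : R -> R, (forall s, S (T s) = s) /\ cont T.
Proof.
set (T := fun s => proj1_sig (constructive_indefinite_description _ (arc_surj s))).
assert (HT : forall s, S (T s) = s).
{ intros s; unfold T; now destruct constructive_indefinite_description. }
exists T; split; auto.
intros s; apply continuity_pt_filterlim; intros eps Heps.
pose proof (S_lt (T s) (T s + eps) ltac:(lra)) as H1.
pose proof (S_lt (T s - eps) (T s) ltac:(lra)) as H2.
rewrite HT in H1, H2.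
exists (Rmin (S (T s + eps) - s) (s - S (T s - eps))); split.
{ apply Rmin_glb_lt; lra. }
intros s' [_ Hs']; simpl in *; unfold R_dist in *.
pose proof (Rmin_l (S (T s + eps) - s) (s - S (T s - eps))).
pose proof (Rmin_r (S (T s + eps) - s) (s - S (T s - eps))).
apply Rabs_def2 in Hs'.
apply Rabs_def1; apply Rnot_le_lt; intros H3.
- pose proof (S_le (T s + eps) (T s') ltac:(lra)) as H4. rewrite HT in H4; lra.
- pose proof (S_le (T s') (T s - eps) ltac:(lra)) as H4. rewrite HT in H4; lra.
Qed.

(** In the arc parameter, the value of [f] at [s + L / 2] minus its value at [s] takes opposite
    values at [0] and at [L / 2], by periodicity, so it vanishes in between. *)
Lemma halving_points (f : R -> R) : cont f -> periodic1 f ->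
  exists p q, p <= q <= p + 1 /\ S q - S p = L / 2 /\ f p = f q.
Proof.
intros Hf Hp; pose proof arc_total_pos as HL.
destruct arc_inverse as [T [HT Tc]].
set (h := fun s => f (T (s + L / 2)) - f (T s)).
assert (hc : cont h).
{ unfold h; cnt; apply (continuous_after f); auto.
  apply (continuous_after T); [cnt|apply Tc]. }
assert (T1 : forall s, T (s + L) = T s + 1).
{ intros s; pose proof (arc_period (T s)) as H; rewrite HT, <- (HT (s + L)) in H.
  destruct (Rtotal_order (T (s + L)) (T s + 1)) as [H0|[H0|H0]]; auto;
  pose proof (S_lt _ _ H0) as H1; lra. }
destruct (IVT_cor h 0 (L / 2)) as [s [Hs Hs0]].
- intros s; apply continuity_pt_filterlim, hc.
- lra.
- unfold h. replace (L / 2 + L / 2) with (0 + L) by field.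
  rewrite T1, Hp, !Rplus_0_l.
  pose proof (pow2_ge_0 (f (T (L / 2)) - f (T 0))). lra.
- assert (Hle : forall s1 s2, s1 <= s2 -> T s1 <= T s2).
  { intros s1 s2 H; apply Rnot_lt_le; intros H0.
    pose proof (S_lt _ _ H0) as H1.
    rewrite !HT in H1; lra. }
  exists (T s), (T (s + L / 2)); repeat split.
  + apply Hle; lra.
  + rewrite <- T1; apply Hle; lra.
  + rewrite !HT; ring.
  + unfold h in Hs0; lra.
Qed.

(* Subtract the common value of [f] at two points halving the total mass, and
   apply the Dirichlet inequality on each half; the mean of [f] being zero,
   the subtraction only increases the left-hand side. *)
Lemma Wirtinger_ineq (f df : R -> R) :
  (forall u, is_derive f u (df u)) -> cont df -> periodic1 f -> periodic1 df ->
  RInt (fun u => f u * v u) 0 1 = 0 ->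
  (2 * PI / L) ^ 2 * RInt (fun u => f u ^ 2 * v u) 0 1
  <= RInt (fun u => df u ^ 2 / v u) 0 1.
Proof.
intros Hf Hdf Hp Hdp H0; pose proof arc_total_pos as HL.
pose proof PI_RGT_0 as HPI.
assert (fc : cont f) by now apply (is_derive_cont f df).
destruct (halving_points f fc Hp) as [p [q [[Hpq Hq1] [HS Hfp]]]].
set (g := fun u => f u - f p).
assert (Hg : forall u, is_derive g u (df u)).
{ intros u; unfold g; derive_by. ring. }
assert (gc : cont g) by now apply (is_derive_cont g df).
assert (Hw : 0 < 2 * PI / L) by (apply Rdiv_lt_0_compat; lra).
assert (E : 2 * PI / L * (L / 2) = PI) by (field; lra).
pose proof (Dirichlet_ineq v v_pos v_cont g df p q (2 * PI / L) Hpq Hg Hdf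
  ltac:(unfold g; ring) ltac:(unfold g; lra) Hw
  ltac:(change (2 * PI / L * (S q - S p) <= PI); rewrite HS, E; lra)) as D1.
pose proof (Dirichlet_ineq v v_pos v_cont g df q (p + 1) (2 * PI / L) Hq1 Hg Hdf
  ltac:(unfold g; lra) ltac:(unfold g; rewrite Hp; ring) Hw
  ltac:(change (2 * PI / L * (S (p + 1) - S q) <= PI); rewrite arc_period;
        replace (S p + L - S q) with (L / 2) by lra; rewrite E; lra)) as D2.
assert (C1 : cont (fun u => g u ^ 2 * v u)) by cnt.
assert (C2 : cont (fun u => df u ^ 2 / v u))
  by cnt.
pose proof (int_Chasles _ p q (p + 1) C1) as E1.
pose proof (int_Chasles _ p q (p + 1) C2) as E2.
rewrite int_periodic in E1; auto;
  [|intros u; unfold g; now rewrite Hp, v_per].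
rewrite int_periodic in E2; auto; [|intros u; now rewrite Hdp, v_per].
assert (E3 : RInt (fun u => g u ^ 2 * v u) 0 1
   = RInt (fun u => f u ^ 2 * v u) 0 1 + f p ^ 2 * L).
{ unfold g, L; rewrite (int_ext _ (fun u => f u ^ 2 * v u
     - 2 * f p * (f u * v u) + f p ^ 2 * v u)) by (intros u; ring).
  rewrite int_plus, int_minus, !int_scal, H0 by cnt. ring_R. }
assert (0 <= f p ^ 2 * L) by (apply Rmult_le_pos; [apply pow2_ge_0|lra]).
pose proof (pow2_ge_0 (2 * PI / L)).
rewrite <- E2; eapply Rle_trans; [|apply (Rplus_le_compat _ _ _ _ D1 D2)].
rewrite <- Rmult_plus_distr_l, E1, E3; apply Rmult_le_compat_l; lra.
Qed.

End PeriodicWirtinger.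

(** * Planar vectors *)

(** Convertible with the complex modulus [Cmod], whence the triangle inequality, and with [dist2]
    applied to differences. *)
Definition norm2 (p q : R) : R := sqrt (p ^ 2 + q ^ 2).

Lemma norm2_sq p q : norm2 p q ^ 2 = p ^ 2 + q ^ 2.
Proof.
apply pow2_sqrt; pose proof (pow2_ge_0 p); pose proof (pow2_ge_0 q); lra.
Qed.

Lemma norm2_ge0 p q : 0 <= norm2 p q.
Proof. apply sqrt_pos. Qed.

Lemma norm2_triangle p q p' q' :
  norm2 (p + p') (q + q') <= norm2 p q + norm2 p' q'.
Proof. exact (Cmod_triangle (p, q) (p', q')). Qed.

Lemma norm2_le_abs p q : norm2 p q <= Rabs p + Rabs q.
Proof.
pose proof (Rabs_pos p); pose proof (Rabs_pos q).
apply Rsqr_incr_0_var; [|lra].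
rewrite !Rsqr_pow2, norm2_sq, <- (pow2_abs p), <- (pow2_abs q).
assert (0 <= Rabs p * Rabs q) by (apply Rmult_le_pos; auto). nra.
Qed.

Lemma abs_le_norm2 p q : Rabs p <= norm2 p q.
Proof.
rewrite <- (sqrt_pow2 (Rabs p)) by apply Rabs_pos.
apply sqrt_le_1_alt; rewrite pow2_abs; pose proof (pow2_ge_0 q); lra.
Qed.

Lemma norm2_eq p q p' q' : p ^ 2 + q ^ 2 = p' ^ 2 + q' ^ 2 ->
  norm2 p q = norm2 p' q'.
Proof. now unfold norm2; intros ->. Qed.

Lemma norm2_scal c p q : 0 <= c -> norm2 (c * p) (c * q) = c * norm2 p q.
Proof.
intros Hc; unfold norm2.
replace ((c * p) ^ 2 + (c * q) ^ 2) with (c ^ 2 * (p ^ 2 + q ^ 2)) by ring.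
rewrite sqrt_mult_alt, sqrt_pow2 by (try apply pow2_ge_0; auto); auto.
Qed.

Lemma cos2_sin2 x : cos x ^ 2 + sin x ^ 2 = 1.
Proof. pose proof (sin2_cos2 x) as H; unfold Rsqr in H; lra. Qed.

Lemma polar_coordinates p q : exists al,
  p = norm2 p q * cos al /\ q = norm2 p q * sin al.
Proof.
destruct (Req_dec (norm2 p q) 0) as [E|E].
{ exists 0; pose proof (norm2_sq p q) as H; rewrite E in *.
  pose proof (pow2_ge_0 p); pose proof (pow2_ge_0 q).
  split; rewrite Rmult_0_l; apply Rsqr_0_uniq; unfold Rsqr; lra. }
pose proof (norm2_ge0 p q); pose proof (norm2_sq p q) as Hn.
set (n := norm2 p q) in *.
assert (Hpn : -1 <= p / n <= 1).
{ pose proof (abs_le_norm2 p q) as H1; fold n in H1; apply Rabs_le_between in H1.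
  split; apply (Rmult_le_reg_r n); try lra;
  unfold Rdiv; rewrite Rmult_assoc, Rinv_l; lra. }
assert (Hs : sin (acos (p / n)) = Rabs (q / n)).
{ rewrite sin_acos by auto. rewrite <- sqrt_Rsqr_abs; f_equal; unfold Rsqr.
  replace (q / n * (q / n)) with ((n ^ 2 - p ^ 2) / n ^ 2)
    by (replace (n ^ 2 - p ^ 2) with (q ^ 2) by lra; field; auto).
  field; auto. }
destruct (Rle_dec 0 q) as [Hq|Hq].
- exists (acos (p / n)); rewrite cos_acos, Hs by auto.
  rewrite Rabs_right by (apply Rle_ge, Rdiv_le_0_compat; lra).
  split; field; auto.
- exists (- acos (p / n)); rewrite cos_neg, sin_neg, cos_acos, Hs by auto.
  rewrite Rabs_left.
  + split; field; auto.
  + apply Ropp_lt_cancel; rewrite Ropp_0.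
    replace (- (q / n)) with ((- q) / n) by (field; auto).
    apply Rdiv_lt_0_compat; lra.
Qed.

Lemma periodic_reduce u : exists r, 0 <= r <= 1 /\
  forall f : R -> R, periodic1 f -> f u = f r.
Proof.
exists (frac_part u); split.
{ destruct (base_fp u); lra. }
assert (N : forall f : R -> R, periodic1 f -> forall n s, f (s + INR n) = f s).
{ intros f Hf n s; induction n as [|n IH].
  - now rewrite Rplus_0_r.
  - rewrite S_INR, <- Rplus_assoc, Hf; auto. }
intros f Hf; unfold frac_part.
destruct ((Z_le_gt_dec 0 (Int_part u))) as [H|H].
- rewrite <- (N f Hf (Z.to_nat (Int_part u)) (u - IZR (Int_part u))).
  rewrite INR_IZR_INZ, Z2Nat.id by auto; f_equal; ring.
- rewrite <- (N f Hf (Z.to_nat (- Int_part u)) u).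
  rewrite INR_IZR_INZ, Z2Nat.id, opp_IZR by lia; f_equal; ring.
Qed.

Lemma periodic_oscillation (F dF G : R -> R) :
  (forall u, is_derive F u (dF u)) -> cont dF -> cont G ->
  (forall u, Rabs (dF u) <= G u) -> periodic1 F ->
  forall u, Rabs (F u - F 0) <= RInt G 0 1.
Proof.
intros HF Hc Gc Hle Hp u.
destruct (periodic_reduce u) as [r [Hr Hf]]; rewrite (Hf F Hp).
rewrite <- (int_derive F dF 0 r HF Hc).
eapply Rle_trans; [apply int_abs_le; [lra|auto]|].
eapply Rle_trans; [apply (int_le _ G); [lra|cnt|auto|auto]|].
assert (0 <= RInt G r 1).
{ apply int_ge0; [lra|auto|]. intros s.
  pose proof (Rabs_pos (dF s)); pose proof (Hle s); lra. }
pose proof (int_Chasles G 0 r 1 Gc); lra.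
Qed.

(** * Closed plane curves *)

Notation int f := (RInt f 0 1 : R).

(** The derivatives are parameters rather than [Derive] terms, so that the time slices of the flow
    enter with their iterated [pd_u]. *)
Record closed_curve (a a1 a2 b b1 b2 : R -> R) : Prop := {
  cc_a : forall u, is_derive a u (a1 u);
  cc_a1 : forall u, is_derive a1 u (a2 u);
  cc_a2 : cont a2;
  cc_b : forall u, is_derive b u (b1 u);
  cc_b1 : forall u, is_derive b1 u (b2 u);
  cc_b2 : cont b2;
  cc_pa : periodic1 a;
  cc_pa1 : periodic1 a1;
  cc_pb : periodic1 b;
  cc_pb1 : periodic1 b1;
  cc_reg : forall u, 0 < sqrt (a1 u ^ 2 + b1 u ^ 2) }.

Section ClosedCurve.
Variables a a1 a2 b b1 b2 : R -> R.
Hypothesis C : closed_curve a a1 a2 b b1 b2.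

Let v u := sqrt (a1 u ^ 2 + b1 u ^ 2).
Let L := int v.
Let w := 2 * PI / L.
(** Derivative in [u] of the tangent angle, that is, speed times the curvature relative to the left
    normal. *)
Let om u := (a1 u * b2 u - b1 u * a2 u) / v u ^ 2.

Let Ha := cc_a _ _ _ _ _ _ C.
Let Ha1 := cc_a1 _ _ _ _ _ _ C.
Let ca2 := cc_a2 _ _ _ _ _ _ C.
Let Hb := cc_b _ _ _ _ _ _ C.
Let Hb1 := cc_b1 _ _ _ _ _ _ C.
Let cb2 := cc_b2 _ _ _ _ _ _ C.
Let pa := cc_pa _ _ _ _ _ _ C.
Let pa1 := cc_pa1 _ _ _ _ _ _ C.
Let pb := cc_pb _ _ _ _ _ _ C.
Let pb1 := cc_pb1 _ _ _ _ _ _ C.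
Let ca : cont a. Proof. exact (is_derive_cont a a1 Ha). Qed.
Let ca1 : cont a1. Proof. exact (is_derive_cont a1 a2 Ha1). Qed.
Let cb : cont b. Proof. exact (is_derive_cont b b1 Hb). Qed.
Let cb1 : cont b1. Proof. exact (is_derive_cont b1 b2 Hb1). Qed.

Let v_pos u : 0 < v u.
Proof. apply (cc_reg _ _ _ _ _ _ C). Qed.

Let v_neq u : v u <> 0.
Proof. apply Rgt_not_eq, v_pos. Qed.

Let v2 u : v u ^ 2 = a1 u ^ 2 + b1 u ^ 2.
Proof. apply norm2_sq. Qed.

Let v2_neq u : v u ^ 2 <> 0.
Proof. apply pow_nonzero, v_neq. Qed.

Let cv : cont v.
Proof. unfold v; cnt. Qed.

Let com : cont om.
Proof. unfold om; cnt. Qed.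

Let pv : periodic1 v.
Proof. intros u; unfold v; now rewrite pa1, pb1. Qed.

Lemma length_pos : 0 < L.
Proof. apply arc_total_pos; auto. Qed.

Let w_pos : 0 < w.
Proof.
pose proof PI_RGT_0; apply Rdiv_lt_0_compat; [lra|apply length_pos].
Qed.

Let wL : w * L = 2 * PI.
Proof. unfold w; field; apply Rgt_not_eq, length_pos. Qed.

Let Hv u : is_derive v u ((a1 u * a2 u + b1 u * b2 u) / v u).
Proof.
pose proof (v_pos u) as H; pose proof (v2 u) as H2.
unfold v; derive_by.
- rewrite <- H2; apply pow_lt, H.
- fold (v u); field; auto.
Qed.

Lemma tangent_derive u :
  is_derive (fun s => a1 s / v s) u (- om u * b1 u / v u) /\
  is_derive (fun s => b1 s / v s) u (om u * a1 u / v u).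
Proof.
split; (derive_by; [auto|]; unfold om; apply Rminus_diag_uniq).
(* [field] does not know [v ^ 2 = a1 ^ 2 + b1 ^ 2]: the numerator is displayed with a factor [v ^ 2]
   on which [v2] can act. *)
- transitivity ((a2 u * v u ^ 2 - a1 u * (a1 u * a2 u + b1 u * b2 u)
    + (a1 u * b2 u - b1 u * a2 u) * b1 u) / v u ^ 3); [field; auto|].
  rewrite v2; field; auto.
- transitivity ((b2 u * v u ^ 2 - b1 u * (a1 u * a2 u + b1 u * b2 u)
    - (a1 u * b2 u - b1 u * a2 u) * a1 u) / v u ^ 3); [field; auto|].
  rewrite v2; field; auto.
Qed.

(* Rotating the unit tangent back by the angle [th] gives a constant vector. *)
Lemma turning_number : exists k : Z, int om = 2 * PI * IZR k.
Proof.
set (th u := RInt om 0 u : R).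
assert (Hth : forall u, is_derive th u (om u)) by
  (intros u; apply is_derive_int; auto).
set (T1 u := a1 u / v u); set (T2 u := b1 u / v u).
assert (HT1 : forall u, is_derive T1 u (- om u * T2 u)).
{ intros u; eapply is_derive_value; [exact (proj1 (tangent_derive u))|].
  unfold T2; field; auto. }
assert (HT2 : forall u, is_derive T2 u (om u * T1 u)).
{ intros u; eapply is_derive_value; [exact (proj2 (tangent_derive u))|].
  unfold T1; field; auto. }
assert (cz : cont (fun _ : R => 0)) by cnt.
assert (E1 : T1 1 * cos (th 1) + T2 1 * sin (th 1)
           = T1 0 * cos (th 0) + T2 0 * sin (th 0)).
{ apply Rminus_diag_uniq.
  rewrite <- (int_derive (fun u => T1 u * cos (th u) + T2 u * sin (th u))
    (fun _ => 0) 0 1); auto.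
  - rewrite RInt_const; unfold scal; simpl; unfold mult; simpl; ring.
  - intros u; derive_by; ring. }
assert (E2 : - T1 1 * sin (th 1) + T2 1 * cos (th 1)
           = - T1 0 * sin (th 0) + T2 0 * cos (th 0)).
{ apply Rminus_diag_uniq.
  rewrite <- (int_derive (fun u => - T1 u * sin (th u) + T2 u * cos (th u))
    (fun _ => 0) 0 1); auto.
  - rewrite RInt_const; unfold scal; simpl; unfold mult; simpl; ring.
  - intros u; derive_by; ring. }
assert (P1 : T1 1 = T1 0)
  by (unfold T1; rewrite <- (Rplus_0_l 1); now rewrite pv, pa1).
assert (P2 : T2 1 = T2 0)
  by (unfold T2; rewrite <- (Rplus_0_l 1); now rewrite pv, pb1).
assert (T0 : th 0 = 0) by (unfold th; now rewrite RInt_point).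
rewrite P1, P2, T0, cos_0, sin_0 in *.
assert (N : T1 0 ^ 2 + T2 0 ^ 2 = 1).
{ unfold T1, T2. transitivity ((a1 0 ^ 2 + b1 0 ^ 2) / v 0 ^ 2); [field; auto|].
  rewrite <- v2; field; auto. }
(* By [E1] and [E2], the rotation by [- th 1] fixes a unit vector, which forces its cosine to be
   1. *)
assert (Hc : cos (th 1) = 1).
{ transitivity ((T1 0 ^ 2 + T2 0 ^ 2) * cos (th 1)); [rewrite N; ring|].
  transitivity (T1 0 * (T1 0 * cos (th 1) + T2 0 * sin (th 1))
    + T2 0 * (- T1 0 * sin (th 1) + T2 0 * cos (th 1))); [ring|].
  rewrite E1, E2; transitivity (T1 0 ^ 2 + T2 0 ^ 2); [ring|exact N]. }
(* The half angle turns [cos = 1] into a zero of [sin], so that [th 1] comes out as an even multiple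
   of [PI]. *)
destruct (sin_eq_0_0 (th 1 / 2)) as [k Hk].
{ replace (th 1) with (2 * (th 1 / 2)) in Hc by field.
  rewrite cos_2a_sin in Hc. apply Rsqr_0_uniq; unfold Rsqr; lra. }
exists k; fold (th 1); lra.
Qed.

(** Twice the signed area; [c1] and [c2] below are the coordinates of the centre of mass for arc
    length. *)
Let q := int (fun u => a u * b1 u - b u * a1 u).
Let c1 := int (fun u => a u * v u) / L.
Let c2 := int (fun u => b u * v u) / L.

Let int_a1 : int a1 = 0.
Proof.
rewrite (int_derive a a1 0 1 Ha ca1), <- (pa 0), Rplus_0_l; ring.
Qed.

Let int_b1 : int b1 = 0.
Proof.
rewrite (int_derive b b1 0 1 Hb cb1), <- (pb 0), Rplus_0_l; ring.
Qed.

(** Moving the origin to the centre of mass only adds multiples of [int a1] and [int b1], which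
    vanish because the curve is closed. *)
Let int_moment :
  int (fun u => (b u - c2) * a1 u - (a u - c1) * b1 u) = - q.
Proof.
rewrite (int_ext _ (fun u => c1 * b1 u - c2 * a1 u
   - (a u * b1 u - b u * a1 u))) by (intros u; ring).
rewrite 2!int_minus, !int_scal, int_a1, int_b1 by (auto; cnt).
fold q; ring.
Qed.

Section Orientation.
Variable sg : R.
Hypothesis sg2 : sg ^ 2 = 1.

Let D := L ^ 2 - 2 * PI * sg * q.
Let Y1 u := a1 u / v u + sg * w * (b u - c2).
Let Y2 u := b1 u / v u - sg * w * (a u - c1).
Let Y u := norm2 (Y1 u) (Y2 u).

Let cY1 : cont Y1. Proof. unfold Y1; cnt. Qed.
Let cY2 : cont Y2. Proof. unfold Y2; cnt. Qed.
Let cY : cont Y. Proof. unfold Y, norm2; cnt. Qed.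

Lemma centered (f : R -> R) : cont f ->
  int (fun u => (f u - int (fun s => f s * v s) / L) * v u) = 0.
Proof.
intros Hf; set (m := _ / L).
rewrite (int_ext _ (fun u => f u * v u - m * v u)) by (intros u; ring).
rewrite int_minus, int_scal by cnt. fold L; unfold m.
field_R; apply Rgt_not_eq, length_pos.
Qed.

(** Expanding the square gives [1 + w ^ 2 * |X - c| ^ 2] plus a cross term. Wirtinger's inequality
    bounds the integral of the second term by [L], and [int_moment] evaluates the cross term, for a
    total of [2 * L - 2 * sg * w * q]. *)
Lemma int_Y2_le : int (fun u => Y u ^ 2 * v u) <= 2 * D / L.
Proof.
pose proof length_pos as HL.
assert (W1 : w ^ 2 * int (fun u => (a u - c1) ^ 2 * v u)
             <= int (fun u => a1 u ^ 2 / v u)).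
{ apply (Wirtinger_ineq v v_pos cv pv (fun u => a u - c1)); auto.
  - intros u; derive_by; ring.
  - intros u; now rewrite pa.
  - now apply centered. }
assert (W2 : w ^ 2 * int (fun u => (b u - c2) ^ 2 * v u)
             <= int (fun u => b1 u ^ 2 / v u)).
{ apply (Wirtinger_ineq v v_pos cv pv (fun u => b u - c2)); auto.
  - intros u; derive_by; ring.
  - intros u; now rewrite pb.
  - now apply centered. }
assert (W3 : int (fun u => a1 u ^ 2 / v u) + int (fun u => b1 u ^ 2 / v u) = L).
{ rewrite <- int_plus by cnt. apply int_ext; intros u.
  transitivity ((a1 u ^ 2 + b1 u ^ 2) / v u); [field; auto|].
  rewrite <- v2; field; auto. }
rewrite (int_ext _ (fun u => v u + w ^ 2 * ((a u - c1) ^ 2 * v u)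
  + w ^ 2 * ((b u - c2) ^ 2 * v u)
  + 2 * sg * w * ((b u - c2) * a1 u - (a u - c1) * b1 u))).
- rewrite !int_plus, !int_scal, int_moment by (auto; cnt). fold L.
  replace (2 * D / L) with (L + L + 2 * sg * w * - q)
    by (unfold D, w; field; lra).
  lra.
- intros u; unfold Y; rewrite norm2_sq; unfold Y1, Y2.
  transitivity ((a1 u ^ 2 + b1 u ^ 2) / v u
    + sg ^ 2 * w ^ 2 * ((a u - c1) ^ 2 + (b u - c2) ^ 2) * v u
    + 2 * sg * w * ((b u - c2) * a1 u - (a u - c1) * b1 u)); [field; auto|].
  rewrite <- v2, sg2; field; auto.
Qed.

(** The isoperimetric inequality in Hurwitz' manner: the left side of [int_Y2_le] is nonnegative.
    Taken with both signs of [sg], it bounds the absolute value of the area. *)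
Lemma isoperimetric : 0 <= D.
Proof.
pose proof length_pos as HL.
assert (H : 0 <= int (fun u => Y u ^ 2 * v u)).
{ apply int_ge0; [lra|cnt|]. intros u.
  apply Rmult_le_pos; [apply pow2_ge_0|apply Rlt_le, v_pos]. }
pose proof int_Y2_le.
replace D with (2 * D / L * (L / 2)) by (field; lra).
apply Rmult_le_pos; lra.
Qed.

Let M := sqrt (2 * D).

(** Cauchy-Schwarz with the factors [Y * sqrt v] and [sqrt v]: the length cancels the denominator of
    [int_Y2_le]. *)
Let int_Y_le : int (fun u => Y u * v u) <= M.
Proof.
pose proof length_pos as HL.
apply Rsqr_incr_0_var; [|apply sqrt_pos].
rewrite !Rsqr_pow2; unfold M; rewrite pow2_sqrt by (pose proof isoperimetric; lra).
assert (sv : forall u, sqrt (v u) ^ 2 = v u)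
  by (intros u; apply pow2_sqrt, Rlt_le, v_pos).
pose proof (int_Cauchy_Schwarz (fun u => Y u * sqrt (v u)) (fun u => sqrt (v u))
  0 1 Rle_0_1 ltac:(cnt) ltac:(cnt)) as H.
cbv beta in H.
rewrite (int_ext _ (fun u => Y u * v u)) in H
  by (intros u; rewrite <- (sv u) at 3; ring).
rewrite (int_ext (fun u => (Y u * sqrt (v u)) ^ 2) (fun u => Y u ^ 2 * v u)) in H
  by (intros u; rewrite <- (sv u) at 2; ring).
rewrite (int_ext (fun u => sqrt (v u) ^ 2) v) in H by auto.
fold L in H; eapply Rle_trans; [exact H|].
replace (2 * D) with (2 * D / L * L) by (field; lra).
apply Rmult_le_compat_r; [lra|apply int_Y2_le].
Qed.

(* [Z = (X - c) exp(- i sg w S)], with [S] the arc length, satisfies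
   [|Z'| = |Y| v], so it stays near a constant; and [| 1 - w |X - c| | <= |Y|]
   fixes the modulus of that constant. *)
Lemma near_circle : exists al, forall u,
  Rabs (a u - c1 - L / (2 * PI) *
    (cos al * cos (w * RInt v 0 u) - sg * sin al * sin (w * RInt v 0 u))) <= 8 * M
  /\
  Rabs (b u - c2 - L / (2 * PI) *
    (sg * cos al * sin (w * RInt v 0 u) + sin al * cos (w * RInt v 0 u))) <= 8 * M.
Proof.
pose proof length_pos as HL; pose proof PI2_1 as HPI.
set (ph u := w * RInt v 0 u : R).
assert (Hph : forall u, is_derive ph u (w * v u)).
{ intros u; unfold ph; derive_by; [apply is_derive_int; auto|ring]. }
assert (pph : forall u, cos (ph (u + 1)) = cos (ph u) /\ sin (ph (u + 1)) = sin (ph u)).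
{ intros u; unfold ph; rewrite arc_period by auto. fold L.
  rewrite Rmult_plus_distr_l, wL.
  split; rewrite ?cos_plus, ?sin_plus, cos_2PI, sin_2PI; ring. }
set (q1 u := a u - c1); set (q2 u := b u - c2).
set (Z1 u := q1 u * cos (ph u) + sg * q2 u * sin (ph u)).
set (Z2 u := - sg * q1 u * sin (ph u) + q2 u * cos (ph u)).
assert (cph : cont ph) by apply (is_derive_cont _ _ Hph).
assert (cY' : cont (fun u => Y u * v u)) by cnt.
assert (HZ1 : forall u, Rabs (Z1 u - Z1 0) <= M).
{ intros u; eapply Rle_trans; [|apply int_Y_le].
  apply (periodic_oscillation Z1
    (fun u => (Y1 u * cos (ph u) + sg * Y2 u * sin (ph u)) * v u)); auto.
  - intros s; unfold Z1, q1, q2; derive_by; unfold Y1, Y2.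
    replace (sg * (b1 s / v s - sg * w * (a s - c1)))
      with (sg * b1 s / v s - sg ^ 2 * w * (a s - c1)) by (field; auto).
    rewrite sg2; field; auto.
  - cnt.
  - intros s; rewrite Rabs_mult, (Rabs_right (v s)) by (apply Rgt_ge, v_pos).
    apply Rmult_le_compat_r; [apply Rlt_le, v_pos|].
    eapply Rle_trans; [apply (abs_le_norm2 _
      (- sg * Y1 s * sin (ph s) + Y2 s * cos (ph s)))|].
    apply Req_le, norm2_eq.
    transitivity ((Y1 s ^ 2 + Y2 s ^ 2) * cos (ph s) ^ 2
      + sg ^ 2 * (Y1 s ^ 2 + Y2 s ^ 2) * sin (ph s) ^ 2); [ring|].
    rewrite sg2; transitivity ((Y1 s ^ 2 + Y2 s ^ 2) * (cos (ph s) ^ 2 + sin (ph s) ^ 2));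
      [ring|rewrite cos2_sin2; ring].
  - intros s; unfold Z1, q1, q2. destruct (pph s) as [-> ->]. now rewrite pa, pb. }
assert (HZ2 : forall u, Rabs (Z2 u - Z2 0) <= M).
{ intros u; eapply Rle_trans; [|apply int_Y_le].
  apply (periodic_oscillation Z2
    (fun u => (- sg * Y1 u * sin (ph u) + Y2 u * cos (ph u)) * v u)); auto.
  - intros s; unfold Z2, q1, q2; derive_by; unfold Y1, Y2.
    replace (- sg * (a1 s / v s + sg * w * (b s - c2)))
      with (- sg * a1 s / v s - sg ^ 2 * w * (b s - c2)) by (field; auto).
    rewrite sg2; field; auto.
  - cnt.
  - intros s; rewrite Rabs_mult, (Rabs_right (v s)) by (apply Rgt_ge, v_pos).
    apply Rmult_le_compat_r; [apply Rlt_le, v_pos|].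
    eapply Rle_trans; [apply (abs_le_norm2 _
      (Y1 s * cos (ph s) + sg * Y2 s * sin (ph s)))|].
    apply Req_le, norm2_eq.
    transitivity ((Y1 s ^ 2 + Y2 s ^ 2) * cos (ph s) ^ 2
      + sg ^ 2 * (Y1 s ^ 2 + Y2 s ^ 2) * sin (ph s) ^ 2); [ring|].
    rewrite sg2; transitivity ((Y1 s ^ 2 + Y2 s ^ 2) * (cos (ph s) ^ 2 + sin (ph s) ^ 2));
      [ring|rewrite cos2_sin2; ring].
  - intros s; unfold Z2, q1, q2. destruct (pph s) as [-> ->]. now rewrite pa, pb. }
set (rho := norm2 (Z1 0) (Z2 0)).
assert (EZ : forall u, norm2 (Z1 u) (Z2 u) = norm2 (q1 u) (q2 u)).
{ intros u; apply norm2_eq; unfold Z1, Z2.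
  transitivity ((q1 u ^ 2 + q2 u ^ 2) * cos (ph u) ^ 2
      + sg ^ 2 * (q1 u ^ 2 + q2 u ^ 2) * sin (ph u) ^ 2); [ring|].
  rewrite sg2; transitivity ((q1 u ^ 2 + q2 u ^ 2) * (cos (ph u) ^ 2 + sin (ph u) ^ 2));
    [ring|rewrite cos2_sin2; ring]. }
assert (HM : 0 <= M) by apply sqrt_pos.
(* The rotation preserves the norm, and each coordinate of [Z] moves by at most [M]. *)
assert (Hn : forall u, Rabs (norm2 (q1 u) (q2 u) - rho) <= 2 * M).
{ intros u; rewrite <- EZ.
  pose proof (norm2_triangle (Z1 0) (Z2 0) (Z1 u - Z1 0) (Z2 u - Z2 0)) as H1.
  pose proof (norm2_triangle (Z1 u) (Z2 u) (Z1 0 - Z1 u) (Z2 0 - Z2 u)) as H2.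
  rewrite !Rplus_minus in H1, H2.
  pose proof (norm2_le_abs (Z1 u - Z1 0) (Z2 u - Z2 0)) as H3.
  pose proof (norm2_le_abs (Z1 0 - Z1 u) (Z2 0 - Z2 u)) as H4.
  rewrite (Rabs_minus_sym (Z1 0)), (Rabs_minus_sym (Z2 0)) in H4.
  specialize (HZ1 u); specialize (HZ2 u); fold rho in H1, H2.
  apply Rabs_le; lra. }
(* The unit tangent is [Y] plus a vector of norm [w * |X - c|], and [|X - c|] is within [2 * M] of
   [rho]. *)
assert (HY : forall u, Rabs (1 - w * rho) <= Y u + w * (2 * M)).
{ intros u.
  assert (E1 : norm2 (a1 u / v u) (b1 u / v u) = 1).
  { unfold norm2; rewrite <- sqrt_1; f_equal.
    transitivity ((a1 u ^ 2 + b1 u ^ 2) / v u ^ 2); [field; auto|].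
    rewrite <- v2; field; auto. }
  assert (E2 : norm2 (- (sg * w * q2 u)) (sg * w * q1 u)
    = w * norm2 (q1 u) (q2 u)).
  { rewrite <- norm2_scal by lra; apply norm2_eq.
    transitivity (sg ^ 2 * ((w * q2 u) ^ 2 + (w * q1 u) ^ 2)); [ring|].
    rewrite sg2; ring. }
  pose proof (norm2_triangle (Y1 u) (Y2 u) (- (sg * w * q2 u)) (sg * w * q1 u)) as H1.
  pose proof (norm2_triangle (a1 u / v u) (b1 u / v u) (- Y1 u) (- Y2 u)) as H2.
  rewrite E1, E2 in *.
  replace (Y1 u + - (sg * w * q2 u)) with (a1 u / v u) in H1 by (unfold Y1, q2; ring).
  replace (Y2 u + sg * w * q1 u) with (b1 u / v u) in H1 by (unfold Y2, q1; ring).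
  replace (a1 u / v u + - Y1 u) with (- (sg * w * q2 u)) in H2 by (unfold Y1, q2; ring).
  replace (b1 u / v u + - Y2 u) with (sg * w * q1 u) in H2 by (unfold Y2, q1; ring).
  rewrite (norm2_eq (- Y1 u) (- Y2 u) (Y1 u) (Y2 u)) in H2 by ring.
  rewrite E1 in H1; rewrite E2 in H2; fold (Y u) in H1, H2.
  specialize (Hn u); apply Rabs_le_between in Hn.
  apply Rabs_le; nra. }
(* Integrating [HY] against the speed gives [2 * PI * |rho - L / (2 * PI)| <= M + 4 * PI * M]. *)
assert (Hr : Rabs (rho - L / (2 * PI)) <= 3 * M).
{ assert (H : Rabs (1 - w * rho) * L <= M + w * L * (2 * M)).
  { unfold L at 1; rewrite <- int_scal by auto.
    apply Rle_trans with (int (fun u => Y u * v u + w * (2 * M) * v u)).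
    - apply int_le; [lra|cnt|cnt|]. intros u. rewrite <- Rmult_plus_distr_r.
      apply Rmult_le_compat_r; [apply Rlt_le, v_pos|apply HY].
    - rewrite int_plus, int_scal by cnt. fold L.
      pose proof int_Y_le; lra. }
  rewrite wL in H.
  assert (E : Rabs (rho - L / (2 * PI)) * (2 * PI) = Rabs (1 - w * rho) * L).
  { rewrite <- (Rabs_right L) at 2 by lra.
    rewrite <- (Rabs_right (2 * PI)) at 2 by lra.
    rewrite <- !Rabs_mult, <- Rabs_Ropp; f_equal.
    rewrite Rmult_minus_distr_r, <- wL; unfold w; field; lra. }
  apply (Rmult_le_reg_r (2 * PI)); [lra|]. rewrite E. nra. }
destruct (polar_coordinates (Z1 0) (Z2 0)) as [al [A1 A2]]; fold rho in A1, A2.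
exists al; intros u; fold (ph u).
assert (X1 : Rabs (Z1 u - L / (2 * PI) * cos al) <= 4 * M).
{ replace (Z1 u - L / (2 * PI) * cos al)
    with ((Z1 u - Z1 0) + (rho - L / (2 * PI)) * cos al) by (rewrite A1; ring).
  eapply Rle_trans; [apply Rabs_triang|]. rewrite Rabs_mult.
  assert (Rabs (cos al) <= 1) by (apply Rabs_le, COS_bound).
  specialize (HZ1 u). pose proof (Rabs_pos (rho - L / (2 * PI))). nra. }
assert (X2 : Rabs (Z2 u - L / (2 * PI) * sin al) <= 4 * M).
{ replace (Z2 u - L / (2 * PI) * sin al)
    with ((Z2 u - Z2 0) + (rho - L / (2 * PI)) * sin al) by (rewrite A2; ring).
  eapply Rle_trans; [apply Rabs_triang|]. rewrite Rabs_mult.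
  assert (Rabs (sin al) <= 1) by (apply Rabs_le, SIN_bound).
  specialize (HZ2 u). pose proof (Rabs_pos (rho - L / (2 * PI))). nra. }
assert (Hsg : Rabs sg = 1).
{ rewrite <- sqrt_1, <- sg2, <- Rsqr_pow2; symmetry; apply sqrt_Rsqr_abs. }
set (d1 := Z1 u - _) in X1; set (d2 := Z2 u - _) in X2.
assert (Hc : Rabs (cos (ph u)) <= 1) by (apply Rabs_le, COS_bound).
assert (Hs : Rabs (sin (ph u)) <= 1) by (apply Rabs_le, SIN_bound).
assert (Hde : forall d e, Rabs d <= 4 * M -> Rabs e <= 1 -> Rabs (d * e) <= 4 * M).
{ intros d e Hd He; rewrite Rabs_mult.
  pose proof (Rabs_pos d); pose proof (Rabs_pos e); nra. }
split.
(* Undoing the rotation mixes the two coordinates, each off by at most [4 * M = M + 3 * M]; hence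
   the constant 8. *)
- replace (a u - c1 - _) with (d1 * cos (ph u) + - (d2 * (sg * sin (ph u)))).
  + eapply Rle_trans; [apply Rabs_triang|]. rewrite Rabs_Ropp.
    pose proof (Hde d1 _ X1 Hc).
    assert (Rabs (d2 * (sg * sin (ph u))) <= 4 * M).
    { apply Hde; auto. rewrite Rabs_mult, Hsg; lra. }
    lra.
  + unfold d1, d2, Z1, Z2; fold (q1 u).
    transitivity (q1 u * (cos (ph u) ^ 2 + sg ^ 2 * sin (ph u) ^ 2)
       - L / (2 * PI) * (cos al * cos (ph u) - sg * sin al * sin (ph u))); [ring|].
    rewrite sg2, Rmult_1_l, cos2_sin2; ring.
- replace (b u - c2 - _) with (d1 * (sg * sin (ph u)) + d2 * cos (ph u)).
  + eapply Rle_trans; [apply Rabs_triang|].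
    pose proof (Hde d2 _ X2 Hc).
    assert (Rabs (d1 * (sg * sin (ph u))) <= 4 * M).
    { apply Hde; auto. rewrite Rabs_mult, Hsg; lra. }
    lra.
  + unfold d1, d2, Z1, Z2; fold (q2 u).
    transitivity (q2 u * (cos (ph u) ^ 2 + sg ^ 2 * sin (ph u) ^ 2)
       - L / (2 * PI) * (sg * cos al * sin (ph u) + sin al * cos (ph u))); [ring|].
    rewrite sg2, Rmult_1_l, cos2_sin2; ring.
Qed.

(** The normal speed of the flow when [sg] is the orientation: [sg * om / v] is then the curvature
    relative to the inward normal. *)
Let V u := sg * om u / v u - w.

(* With [T] the unit tangent, [D / L = - (1/w) int <Y, T> V v]; then
   [- (1/w) <Y, T> V <= |Y|^2 / 4 + V^2 / w^2]. *)
Lemma deficit_le_energy : int (fun u => V u * v u) = 0 ->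
  D <= L ^ 3 / (2 * PI ^ 2) * int (fun u => V u ^ 2 * v u).
Proof.
intros HV0; pose proof length_pos as HL; pose proof PI_RGT_0 as HPI.
assert (cV : cont V) by (unfold V; cnt).
set (y u := (Y1 u * a1 u + Y2 u * b1 u) / v u).
assert (cy : cont y) by (unfold y; cnt).
assert (Ey : int (fun u => y u * (V u * v u)) = - w * (D / L)).
{ rewrite (int_ext _ (fun u => V u * v u
     + w * ((b u - c2) * (om u * a1 u / v u) + (a u - c1) * (- om u * b1 u / v u))
     - sg * w ^ 2 * ((b u - c2) * a1 u - (a u - c1) * b1 u))).
  - rewrite int_minus, int_plus, !int_scal, HV0, int_moment by (auto; cnt).
    (* Minkowski's formula: the integrand is [<X - c, T'>], which integration by parts turns into
       [- <X', T> = - v]. *)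
    assert (EL : int (fun u => (b u - c2) * (om u * a1 u / v u)
        + (a u - c1) * (- om u * b1 u / v u)) = - L).
    { rewrite (int_ext _ (fun u => (b1 u * (b1 u / v u)
         + (b u - c2) * (om u * a1 u / v u) + (a1 u * (a1 u / v u)
         + (a u - c1) * (- om u * b1 u / v u))) - v u)).
      - rewrite int_minus by cnt.
        rewrite (int_derive (fun u => (b u - c2) * (b1 u / v u)
          + (a u - c1) * (a1 u / v u))).
        + rewrite <- (Rplus_0_l 1), pv, pa, pb, pa1, pb1, Rplus_0_l. fold L.
          ring_R.
        + intros u; destruct (tangent_derive u) as [H1 H2].
          eapply is_derive_value; [apply is_derive_Rplus; apply is_derive_Rmult;
            [der|exact H2|der|exact H1]|]. cbv beta; ring.
        + cnt.
      - intros u.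
        transitivity ((b u - c2) * (om u * a1 u / v u)
         + (a u - c1) * (- om u * b1 u / v u) + (a1 u ^ 2 + b1 u ^ 2) / v u - v u);
          [|field; auto].
        rewrite <- v2; field; auto. }
    rewrite EL. unfold D; replace w with (2 * PI / L) by reflexivity; field; lra.
  - intros u; unfold y, V, Y1, Y2.
    transitivity ((a1 u ^ 2 + b1 u ^ 2) / v u ^ 2 * (sg * om u - w * v u)
       + w * ((b u - c2) * a1 u - (a u - c1) * b1 u)
         * (sg ^ 2 * om u / v u - sg * w)); [field; auto|].
    rewrite <- v2, sg2; field; auto. }
(* With the weight [/ 4], [int_Y2_le] bounds the first term by half of [D / L], which is absorbed on
   the left. *)
assert (Hle : D / L <= / 4 * int (fun u => Y u ^ 2 * v u)
   + / w ^ 2 * int (fun u => V u ^ 2 * v u)).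
{ replace (D / L) with (- / w * (- w * (D / L))) by (field; lra).
  rewrite <- Ey, <- !int_scal, <- int_plus by cnt.
  apply int_le; [lra|cnt|cnt|]. intros u.
  assert (Hy : y u ^ 2 <= Y u ^ 2).
  { unfold Y; rewrite norm2_sq; unfold y.
    assert (0 <= ((Y1 u * b1 u - Y2 u * a1 u) / v u) ^ 2) by apply pow2_ge_0.
    assert (Y1 u ^ 2 + Y2 u ^ 2 = ((Y1 u * a1 u + Y2 u * b1 u) / v u) ^ 2
      + ((Y1 u * b1 u - Y2 u * a1 u) / v u) ^ 2); [|lra].
    transitivity ((Y1 u ^ 2 + Y2 u ^ 2) * (a1 u ^ 2 + b1 u ^ 2) / v u ^ 2);
      [rewrite <- v2; field; auto|field; auto]. }
  assert (0 <= (y u / 2 + V u / w) ^ 2) by apply pow2_ge_0.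
  assert (E : (y u / 2 + V u / w) ^ 2
     = / 4 * y u ^ 2 + / w ^ 2 * V u ^ 2 + / w * y u * V u) by (field; lra).
  replace (- / w * (y u * (V u * v u))) with (- (/ w * y u * V u) * v u) by ring.
  replace (/ 4 * (Y u ^ 2 * v u) + / w ^ 2 * (V u ^ 2 * v u))
    with ((/ 4 * Y u ^ 2 + / w ^ 2 * V u ^ 2) * v u) by ring.
  apply Rmult_le_compat_r; [apply Rlt_le, v_pos|lra]. }
pose proof int_Y2_le as H2.
set (E := int (fun u => V u ^ 2 * v u)) in *.
assert (H3 : D / (2 * L) <= / w ^ 2 * E).
{ replace (D / (2 * L)) with (D / L - / 4 * (2 * D / L)) by (field; lra). lra. }
replace D with (D / (2 * L) * (2 * L)) by (field; lra).
replace (L ^ 3 / (2 * PI ^ 2) * E) with (/ w ^ 2 * E * (2 * L))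
  by (unfold w; field; lra).
apply Rmult_le_compat_r; lra.
Qed.

End Orientation.
End ClosedCurve.

(** * Smooth families *)

(** The last letter of a word is the innermost derivative, so the derivatives of [pd_t f] and
    [pd_u f] are those of [f] along longer words; this makes [smooth2] stable under
    differentiation. *)
Lemma iter_pd_app w b f :
  iter_pd (w ++ b :: nil) f = iter_pd w (if b then pd_t f else pd_u f).
Proof. induction w as [|c w IH]; simpl; [now destruct b|now rewrite IH]. Qed.

Lemma smooth2_pd (b : bool) f :
  smooth2 f -> smooth2 (if b then pd_t f else pd_u f).
Proof. intros H w; rewrite <- iter_pd_app; apply H. Qed.

Lemma smooth2_pd_t f : smooth2 f -> smooth2 (pd_t f).
Proof. apply (smooth2_pd true). Qed.

Lemma smooth2_pd_u f : smooth2 f -> smooth2 (pd_u f).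
Proof. apply (smooth2_pd false). Qed.

Lemma smooth2_is_derive_t f : smooth2 f ->
  forall t u, is_derive (fun s => f s u) t (pd_t f t u).
Proof. intros H t u; apply Derive_correct, (H nil t u). Qed.

Lemma smooth2_is_derive_u f : smooth2 f ->
  forall t u, is_derive (f t) u (pd_u f t u).
Proof. intros H t u; apply Derive_correct, (H nil t u). Qed.

Lemma smooth2_continuous f : smooth2 f ->
  forall t u, continuous (fun p => f (fst p) (snd p)) (t, u).
Proof. intros H t u; apply (H nil t u). Qed.

Lemma smooth2_cont f : smooth2 f -> forall t, cont (f t).
Proof. intros H t; apply (is_derive_cont _ (pd_u f t)), smooth2_is_derive_u, H. Qed.

Lemma smooth2_Schwarz f : smooth2 f ->
  forall t u, pd_t (pd_u f) t u = pd_u (pd_t f) t u.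
Proof.
intros H t u; apply (Schwarz f t u).
- exists (mkposreal 1 Rlt_0_1); intros r s _ _; repeat split.
  + apply (H nil r s).
  + apply (H nil r s).
  + apply (H (false :: nil)%list r s).
  + apply (H (true :: nil)%list r s).
- apply continuity_2d_pt_filterlim, (H (true :: false :: nil)%list t u).
- apply continuity_2d_pt_filterlim, (H (false :: true :: nil)%list t u).
Qed.

Lemma periodic_derive (f df : R -> R) :
  (forall u, is_derive f u (df u)) -> periodic1 f -> periodic1 df.
Proof.
intros Hf Hp u.
assert (H : is_derive (fun s => f (s + 1)) u (df (u + 1))).
{ eapply is_derive_value;
    [apply (is_derive_after (fun s => s + 1) u); [der|apply Hf]|ring]. }
apply (is_derive_ext _ f) in H; [|apply Hp].
now rewrite <- (is_derive_unique _ _ _ H), (is_derive_unique _ _ _ (Hf u)).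
Qed.

Lemma locally_pos t : 0 < t -> locally t (fun s => 0 < s).
Proof. apply (open_gt 0). Qed.

Lemma is_derive_int_param (f ft : R -> R -> R) :
  (forall t u, 0 < t -> is_derive (fun s => f s u) t (ft t u)) ->
  (forall t u, 0 < t -> continuous (fun p => ft (fst p) (snd p)) (t, u)) ->
  (forall t, 0 < t -> cont (f t)) ->
  forall t, 0 < t -> is_derive (fun s => int (f s)) t (int (ft t)).
Proof.
intros Hd Hc Hf t Ht.
eapply is_derive_value.
- apply (is_derive_RInt_param f 0 1 t).
  + apply (filter_imp (fun s => 0 < s)); [|now apply locally_pos].
    intros s Hs u _; eexists; now apply Hd.
  + intros u _; apply continuity_2d_pt_ext_loc with ft.
    * apply locally_2d_locally.
      destruct (locally_pos t Ht) as [e He]; exists e.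
      intros [s r] [H1 _]; symmetry; apply is_derive_unique, Hd, He, H1.
    * now apply continuity_2d_pt_filterlim, Hc.
  + apply (filter_imp (fun s => 0 < s)); [|now apply locally_pos].
    intros s Hs; now apply cont_ex_RInt, Hf.
- apply int_ext; intros u; now apply is_derive_unique, Hd.
Qed.

(** * Functions on a half-line *)

Lemma nonincreasing_of_derive (f df : R -> R) s t : s <= t ->
  (forall r, s <= r <= t -> is_derive f r (df r)) ->
  (forall r, s <= r <= t -> df r <= 0) -> f t <= f s.
Proof.
intros Hst Hf Hle.
destruct (MVT_gen f s t df) as [c [Hc E]].
- intros r Hr; rewrite Rmin_left, Rmax_right in Hr by lra; apply Hf; lra.
- intros r Hr; rewrite Rmin_left, Rmax_right in Hr by lra.
  apply continuity_pt_filterlim, (ex_derive_continuous (V := R_NormedModule)).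
  eexists; apply Hf; lra.
- rewrite Rmin_left, Rmax_right in Hc by lra. specialize (Hle c Hc). nra.
Qed.

Definition tends_to (f : R -> R) (l : R) : Prop :=
  forall eps, 0 < eps -> exists T, forall t, T <= t -> Rabs (f t - l) < eps.

Lemma nonincreasing_tends_to (f : R -> R) m :
  (forall s t, 1 <= s -> s <= t -> f t <= f s) ->
  (forall t, 1 <= t -> m <= f t) -> exists l, m <= l /\ tends_to f l.
Proof.
intros Hd Hm.
destruct (completeness (fun z => exists t, 1 <= t /\ z = - f t)) as [l [Hu Hl]].
- exists (- m); intros z [t [Ht ->]]; specialize (Hm t Ht); lra.
- exists (- f 1), 1; lra.
- exists (- l); split.
  { enough (l <= - m) by lra. apply Hl.
    intros z [t [Ht ->]]; specialize (Hm t Ht); lra. }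
  intros eps He.
  assert (exists T, 1 <= T /\ - l <= f T < - l + eps) as [T [HT H]].
  { apply NNPP; intros N.
    assert (l <= l - eps); [|lra].
    apply Hl; intros z [t [Ht ->]]; apply Rnot_lt_le; intros Hlt.
    apply N; exists t; repeat split; try lra.
    enough (- f t <= l) by lra. apply Hu; now exists t. }
  exists T; intros t Ht.
  assert (- f t <= l) by (apply Hu; exists t; split; auto; lra).
  specialize (Hd T t HT Ht). apply Rabs_def1; lra.
Qed.

Lemma tends_to_plus f g l m : tends_to f l -> tends_to g m ->
  tends_to (fun t => f t + g t) (l + m).
Proof.
intros Hf Hg eps He.
destruct (Hf (eps / 2)) as [T1 H1]; [lra|]; destruct (Hg (eps / 2)) as [T2 H2]; [lra|].
exists (Rmax T1 T2); intros t Ht.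
pose proof (Rmax_l T1 T2); pose proof (Rmax_r T1 T2).
specialize (H1 t ltac:(lra)); specialize (H2 t ltac:(lra)).
apply Rabs_def2 in H1; apply Rabs_def2 in H2; apply Rabs_def1; lra.
Qed.

Lemma tends_to_scal c f l : tends_to f l -> tends_to (fun t => c * f t) (c * l).
Proof.
intros Hf eps He; pose proof (Rabs_pos c).
destruct (Hf (eps / (Rabs c + 1))) as [T HT].
{ apply Rdiv_lt_0_compat; lra. }
exists T; intros t Ht; specialize (HT t Ht).
rewrite <- Rmult_minus_distr_l, Rabs_mult.
pose proof (Rabs_pos (f t - l)).
apply Rle_lt_trans with ((Rabs c + 1) * Rabs (f t - l)); [nra|].
replace eps with ((Rabs c + 1) * (eps / (Rabs c + 1))) by (field; lra).
apply Rmult_lt_compat_l; lra.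
Qed.

(* [f + B] and [f - B] are monotone. *)
Lemma tends_to_of_derive_bound (f df B dB : R -> R) :
  (forall t, 0 < t -> is_derive f t (df t)) ->
  (forall t, 0 < t -> is_derive B t (dB t)) ->
  (forall t, 1 <= t -> Rabs (df t) <= - dB t) ->
  (forall t, 1 <= t -> 0 <= B t) -> exists l, tends_to f l.
Proof.
intros Hf HB Hle Hpos.
assert (N : forall (g dg : R -> R), (forall t, 0 < t -> is_derive g t (dg t)) ->
  (forall t, 1 <= t -> dg t <= 0) -> forall s t, 1 <= s -> s <= t -> g t <= g s).
{ intros g dg Hg Hn s t Hs Hst.
  apply (nonincreasing_of_derive g dg); auto; intros r Hr; [apply Hg|apply Hn]; lra. }
destruct (nonincreasing_tends_to B 0) as [lB [_ HlB]]; auto.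
{ apply (N B dB); auto. intros t Ht; specialize (Hle t Ht).
  pose proof (Rabs_pos (df t)); lra. }
destruct (nonincreasing_tends_to (fun t => f t + B t) (f 1 - B 1)) as [l [_ Hl]].
- apply (N _ (fun t => df t + dB t)).
  + intros t Ht; apply is_derive_Rplus; auto.
  + intros t Ht; specialize (Hle t Ht); pose proof (Rle_abs (df t)); lra.
(* [f + B] is bounded below because [f + B >= f - B] and [f - B] is nondecreasing. *)
- intros t Ht.
  pose proof (N (fun t => B t - f t) (fun t => dB t - df t)
    ltac:(intros; apply is_derive_Rminus; auto)
    ltac:(intros r Hr; specialize (Hle r Hr); pose proof (Rle_abs (- df r)) as H;
          rewrite Rabs_Ropp in H; lra) 1 t ltac:(lra) Ht) as H.
  specialize (Hpos t Ht); cbv beta in H; lra.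
- exists (l + -1 * lB); intros eps He.
  destruct (tends_to_plus _ _ _ _ Hl (tends_to_scal (-1) _ _ HlB) eps He) as [T HT].
  exists T; intros t Ht; specialize (HT t Ht).
  now replace (f t + B t + -1 * B t) with (f t) in HT by ring.
Qed.

(** Two different values are at least [2 * PI] apart, so the intermediate value theorem would
    produce the smaller one plus [PI], which is not a multiple of [2 * PI]. *)
Lemma quantized_constant (g : R -> R) :
  (forall t, 0 < t -> continuous g t) ->
  (forall t, 0 < t -> exists k : Z, g t = 2 * PI * IZR k) ->
  forall s t, 0 < s -> 0 < t -> g s = g t.
Proof.
intros Hc Hk; pose proof PI_RGT_0 as HPI.
assert (N : forall s y, 0 < s -> (exists k : Z, y = 2 * PI * IZR k) -> g s <> y + PI).
{ intros s y Hs [k ->] E; destruct (Hk s Hs) as [m Hm]; rewrite Hm in E.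
  assert (E' : IZR (2 * m) = IZR (2 * k + 1)).
  { rewrite plus_IZR, !mult_IZR; apply (Rmult_eq_reg_l PI); lra. }
  apply eq_IZR in E'; lia. }
assert (G : forall s t, 0 < s -> 0 < t -> g s < g t -> g s + PI < g t).
{ intros s t Hs Ht Hlt; destruct (Hk s Hs) as [k E]; destruct (Hk t Ht) as [m E'].
  rewrite E, E' in *.
  assert (IZR k < IZR m) by (apply (Rmult_lt_reg_l (2 * PI)); lra).
  assert (H1 : IZR (k + 1) <= IZR m) by (apply IZR_le; apply lt_IZR in H; lia).
  rewrite plus_IZR in H1. nra. }
assert (M : forall s t, 0 < s -> s < t -> g s = g t).
{ intros s t Hs Hst.
  assert (Hcc : forall r, s <= r <= t -> continuity_pt g r).
  { intros r Hr; apply continuity_pt_filterlim, Hc; lra. }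
  destruct (Rtotal_order (g s) (g t)) as [H|[H|H]]; auto; exfalso.
  - destruct (IVT_interv (fun r => g r - (g s + PI)) s t) as [z [Hz E]]; try lra.
    + intros r Hr; apply continuity_pt_minus; [now apply Hcc|].
      apply continuity_pt_const; now intros ? ?.
    + specialize (G s t Hs ltac:(lra) H); lra.
    + apply (N z (g s)); try lra. now apply Hk.
  - destruct (IVT_interv (fun r => (g t + PI) - g r) s t) as [z [Hz E]]; try lra.
    + intros r Hr; apply continuity_pt_minus; [|now apply Hcc].
      apply continuity_pt_const; now intros ? ?.
    + specialize (G t s ltac:(lra) Hs H); lra.
    + apply (N z (g t)); try lra. apply Hk; lra. }
intros s t Hs Ht; destruct (Rtotal_order s t) as [H|[H|H]].
- now apply M.
- now rewrite H.
- symmetry; now apply M.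
Qed.

(** * The flow *)

(* Otherwise failing unifications unfold these constants, at a huge cost. *)
Local Opaque Derive RInt.

Section GageFlow.
Variables (x0 y0 : R -> R) (x y : R -> R -> R).
Hypothesis F : gage_flow_global x0 y0 x y.

Let xu := pd_u x. Let xt := pd_t x.
Let yu := pd_u y. Let yt := pd_t y.
Let xuu := pd_u xu. Let xut := pd_t xu.
Let yuu := pd_u yu. Let yut := pd_t yu.
Let xuut := pd_t xuu. Let xtt := pd_t xt.
Let yuut := pd_t yuu. Let ytt := pd_t yt.

Let Sx : smooth2 x. Proof. apply F. Qed.
Let Sy : smooth2 y. Proof. apply F. Qed.
Let Sxu : smooth2 xu. Proof. apply smooth2_pd_u, Sx. Qed.
Let Syu : smooth2 yu. Proof. apply smooth2_pd_u, Sy. Qed.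
Let Sxt : smooth2 xt. Proof. apply smooth2_pd_t, Sx. Qed.
Let Syt : smooth2 yt. Proof. apply smooth2_pd_t, Sy. Qed.
Let Sxuu : smooth2 xuu. Proof. apply smooth2_pd_u, Sxu. Qed.
Let Syuu : smooth2 yuu. Proof. apply smooth2_pd_u, Syu. Qed.
Let Sxut : smooth2 xut. Proof. apply smooth2_pd_t, Sxu. Qed.
Let Syut : smooth2 yut. Proof. apply smooth2_pd_t, Syu. Qed.
Let Sxuut : smooth2 xuut. Proof. apply smooth2_pd_t, Sxuu. Qed.
Let Syuut : smooth2 yuut. Proof. apply smooth2_pd_t, Syuu. Qed.
Let Sxtt : smooth2 xtt. Proof. apply smooth2_pd_t, Sxt. Qed.
Let Sytt : smooth2 ytt. Proof. apply smooth2_pd_t, Syt. Qed.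

Let d_x : forall t u, is_derive (fun s => x s u) t (xt t u) :=
  smooth2_is_derive_t x Sx.
Let d_y : forall t u, is_derive (fun s => y s u) t (yt t u) :=
  smooth2_is_derive_t y Sy.
Let d_xu : forall t u, is_derive (fun s => xu s u) t (xut t u) :=
  smooth2_is_derive_t xu Sxu.
Let d_yu : forall t u, is_derive (fun s => yu s u) t (yut t u) :=
  smooth2_is_derive_t yu Syu.
Let d_xt : forall t u, is_derive (fun s => xt s u) t (xtt t u) :=
  smooth2_is_derive_t xt Sxt.
Let d_yt : forall t u, is_derive (fun s => yt s u) t (ytt t u) :=
  smooth2_is_derive_t yt Syt.
Let d_xuu : forall t u, is_derive (fun s => xuu s u) t (xuut t u) :=
  smooth2_is_derive_t xuu Sxuu.
Let d_yuu : forall t u, is_derive (fun s => yuu s u) t (yuut t u) :=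
  smooth2_is_derive_t yuu Syuu.

Let c_x := smooth2_continuous x Sx.
Let c_y := smooth2_continuous y Sy.
Let c_xu := smooth2_continuous xu Sxu.
Let c_yu := smooth2_continuous yu Syu.
Let c_xt := smooth2_continuous xt Sxt.
Let c_yt := smooth2_continuous yt Syt.
Let c_xuu := smooth2_continuous xuu Sxuu.
Let c_yuu := smooth2_continuous yuu Syuu.
Let c_xut := smooth2_continuous xut Sxut.
Let c_yut := smooth2_continuous yut Syut.
Let c_xuut := smooth2_continuous xuut Sxuut.
Let c_yuut := smooth2_continuous yuut Syuut.
Let c_xtt := smooth2_continuous xtt Sxtt.
Let c_ytt := smooth2_continuous ytt Sytt.

Let k_x := smooth2_cont x Sx.
Let k_y := smooth2_cont y Sy.
Let k_xu := smooth2_cont xu Sxu.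
Let k_yu := smooth2_cont yu Syu.
Let k_xt := smooth2_cont xt Sxt.
Let k_yt := smooth2_cont yt Syt.
Let k_xuu := smooth2_cont xuu Sxuu.
Let k_yuu := smooth2_cont yuu Syuu.
Let k_xut := smooth2_cont xut Sxut.
Let k_yut := smooth2_cont yut Syut.

(** These quantities unfold to those of a closed plane curve frozen at time [t], so the inequalities
    for a fixed curve transfer by conversion. *)
Let v t u := sqrt (xu t u ^ 2 + yu t u ^ 2).
Let L t := int (v t).
Let om t u := (xu t u * yuu t u - yu t u * xuu t u) / v t u ^ 2.
Let q t := int (fun u => x t u * yu t u - y t u * xu t u).
Let sg t := orient (x t) (y t).
Let V t u := sg t * om t u / v t u - 2 * PI / L t.
Let E t := int (fun u => V t u ^ 2 * v t u).

Let v_pos t u : 0 <= t -> 0 < v t u.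
Proof. intros Ht; apply F; auto. Qed.

Let v_neq t u : 0 <= t -> v t u <> 0.
Proof. intros Ht; now apply Rgt_not_eq, v_pos. Qed.

Let v2 t u : v t u ^ 2 = xu t u ^ 2 + yu t u ^ 2.
Proof. apply norm2_sq. Qed.

Let Cu t : 0 <= t -> closed_curve (x t) (xu t) (xuu t) (y t) (yu t) (yuu t).
Proof.
intros Ht.
assert (px : periodic1 (x t)) by now apply F.
assert (py : periodic1 (y t)) by now apply F.
split; auto.
- now apply smooth2_is_derive_u.
- now apply smooth2_is_derive_u.
- now apply smooth2_is_derive_u.
- now apply smooth2_is_derive_u.
- now apply (periodic_derive (x t)), px; apply smooth2_is_derive_u.
- now apply (periodic_derive (y t)), py; apply smooth2_is_derive_u.
- intros u; now apply v_pos.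
Qed.

Let L_pos t : 0 <= t -> 0 < L t.
Proof. intros Ht; apply (length_pos _ _ _ _ _ _ (Cu t Ht)). Qed.

Let sg_cases t : sg t = 1 \/ sg t = -1.
Proof. unfold sg, orient; destruct Rlt_dec; auto. Qed.

Let sg2 t : sg t ^ 2 = 1.
Proof. destruct (sg_cases t) as [-> | ->]; ring. Qed.

Let sg_q t : 0 <= sg t * q t.
Proof.
unfold sg, orient; destruct Rlt_dec as [H|H]; unfold signed_area in H;
change (RInt _ 0 1) with (q t) in H; lra.
Qed.

Let flow t u : 0 <= t ->
  xt t u = V t u * (sg t * - yu t u / v t u) /\
  yt t u = V t u * (sg t * xu t u / v t u).
Proof.
intros Ht; destruct F as [_ [_ [_ [_ [_ H]]]]].
destruct (H t u Ht) as [H1 H2].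
assert (EV : curvature (x t) (y t) u - 2 * PI / length (x t) (y t) = V t u).
(* [Derive_n _ 2] and the iterated [pd_u] are convertible, so only powers of [v] have to be
   rearranged. *)
{ transitivity (sg t * (xu t u * yuu t u - yu t u * xuu t u) / v t u ^ 3
    - 2 * PI / L t); [reflexivity|].
  unfold V, om; f_equal; field; now apply v_neq. }
rewrite EV in H1, H2; split; [exact H1|exact H2].
Qed.

Let velocity_ends t : 0 < t -> xt t 1 = xt t 0 /\ yt t 1 = yt t 0.
Proof.
intros Ht; split; (apply Derive_ext_loc, (filter_imp (fun s => 0 < s));
  [|now apply locally_pos]); intros s Hs; rewrite <- (Rplus_0_l 1); apply F; lra.
Qed.

Local Opaque pd_t pd_u.

Let kv t : cont (v t).
Proof. unfold v; cnt; [exact (k_xu t _)|exact (k_yu t _)]. Qed.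

(* Each function appears twice because [cnt] may leave it eta-reduced. *)
Ltac kleaf := lazymatch goal with
  | |- continuous (fun _ => x ?t _) ?u => exact (k_x t u)
  | |- continuous (x ?t) ?u => exact (k_x t u)
  | |- continuous (fun _ => y ?t _) ?u => exact (k_y t u)
  | |- continuous (y ?t) ?u => exact (k_y t u)
  | |- continuous (fun _ => xu ?t _) ?u => exact (k_xu t u)
  | |- continuous (xu ?t) ?u => exact (k_xu t u)
  | |- continuous (fun _ => yu ?t _) ?u => exact (k_yu t u)
  | |- continuous (yu ?t) ?u => exact (k_yu t u)
  | |- continuous (fun _ => xt ?t _) ?u => exact (k_xt t u)
  | |- continuous (xt ?t) ?u => exact (k_xt t u)
  | |- continuous (fun _ => yt ?t _) ?u => exact (k_yt t u)
  | |- continuous (yt ?t) ?u => exact (k_yt t u)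
  | |- continuous (fun _ => xuu ?t _) ?u => exact (k_xuu t u)
  | |- continuous (xuu ?t) ?u => exact (k_xuu t u)
  | |- continuous (fun _ => yuu ?t _) ?u => exact (k_yuu t u)
  | |- continuous (yuu ?t) ?u => exact (k_yuu t u)
  | |- continuous (fun _ => xut ?t _) ?u => exact (k_xut t u)
  | |- continuous (xut ?t) ?u => exact (k_xut t u)
  | |- continuous (fun _ => yut ?t _) ?u => exact (k_yut t u)
  | |- continuous (yut ?t) ?u => exact (k_yut t u)
  | |- continuous (fun _ => v ?t _) ?u => exact (kv t u)
  | |- continuous (v ?t) ?u => exact (kv t u)
  | |- _ <> 0 => first [now apply pow_nonzero, v_neq | now apply v_neq]
  end.

Let kom t : 0 <= t -> cont (om t).
Proof.
intros Ht; unfold om; cnt; kleaf.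
Qed.

Let kV t : 0 <= t -> cont (V t).
Proof. intros Ht; unfold V; cnt; first [kleaf | exact (kom _ Ht _)]. Qed.

Let cv t u : continuous (fun p => v (fst p) (snd p)) (t, u).
Proof. unfold v; cnt. Qed.

(** * First variation of speed and length *)

Let dv t u : 0 < t ->
  is_derive (fun s => v s u) t ((xu t u * xut t u + yu t u * yut t u) / v t u).
Proof.
intros Ht; assert (H := v_pos t u (Rlt_le _ _ Ht)).
pose proof (v2 t u) as H2.
unfold v at 1; derive_by.
- rewrite <- H2; apply pow_lt, H.
- fold (v t u); field; apply Rgt_not_eq, H.
Qed.

(* The velocity is normal, so [<X_tu, T> = - <X_t, T_u>]. *)
Let speed_variation t u : 0 < t ->
  (xu t u * xut t u + yu t u * yut t u) / v t u
  = - (V t u * (V t u + 2 * PI / L t) * v t u).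
Proof.
intros Ht; assert (Hv := v_neq t u (Rlt_le _ _ Ht)).
assert (H : is_derive (fun r => xu t r * xt t r + yu t r * yt t r) u
  (xuu t u * xt t u + xu t u * xut t u + (yuu t u * yt t u + yu t u * yut t u))).
{ unfold xut, xu at 3, yut, yu at 3.
  rewrite (smooth2_Schwarz x Sx), (smooth2_Schwarz y Sy).
  eapply is_derive_value; [apply is_derive_Rplus; apply is_derive_Rmult;
    apply smooth2_is_derive_u; auto|reflexivity]. }
apply (is_derive_ext _ (fun _ => 0)) in H.
2:{ intros r; destruct (flow t r (Rlt_le _ _ Ht)) as [-> ->].
    unfold Rdiv; ring_R. }
apply is_derive_unique in H; rewrite Derive_const in H.
destruct (flow t u (Rlt_le _ _ Ht)) as [E1 E2]; rewrite E1, E2 in H.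
transitivity ((- (V t u * (sg t * (xu t u * yuu t u - yu t u * xuu t u) / v t u)))
  / v t u).
- f_equal; unfold Rdiv in *; lra.
- unfold V at 3, om; field; split; auto. apply Rgt_not_eq, L_pos; lra.
Qed.

(* [h = 1] gives the variation of length, [h = x] and [h = y] those of the
   centre of mass. *)
Let weighted_length_derive h ht :
  (forall t u, is_derive (fun s => h s u) t (ht t u)) ->
  (forall t u, continuous (fun p => h (fst p) (snd p)) (t, u)) ->
  (forall t u, continuous (fun p => ht (fst p) (snd p)) (t, u)) ->
  (forall t, cont (h t)) -> forall t, 0 < t ->
  is_derive (fun s => int (fun u => h s u * v s u)) t
    (int (fun u => ht t u * v t u
                   - h t u * (V t u * (V t u + 2 * PI / L t) * v t u))).
Proof.
intros d_h c_h c_ht k_h t Ht.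
eapply is_derive_value.
- apply (is_derive_int_param (fun s u => h s u * v s u) (fun s u =>
    ht s u * v s u + h s u * ((xu s u * xut s u + yu s u * yut s u) / v s u)));
    auto.
  + intros s u Hs; derive_by; reflexivity.
  + intros s u Hs; cnt; simpl; apply v_neq; lra.
  + intros s Hs; cnt; [exact (k_h s _)|kleaf].
- apply int_ext; intros u; rewrite speed_variation by auto; ring.
Qed.

(** [V + 2 * PI / L] is the curvature. Reducing the integral to that of [V ^ 2] requires [V] to have
    mean zero, hence the value of the turning number, which is determined only later. *)
Let length_derive t : 0 < t ->
  is_derive L t (- int (fun u => V t u * (V t u + 2 * PI / L t) * v t u)).
Proof.
intros Ht; assert (kVt := kV t (Rlt_le _ _ Ht)).
apply (is_derive_ext (fun s => int (fun u => 1 * v s u))).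
{ intros s; apply int_ext; intros u; ring. }
eapply is_derive_value.
- apply (weighted_length_derive (fun _ _ => 1) (fun _ _ => 0)); auto.
  + intros s u; der.
  + intros s u; cnt.
  + intros s u; cnt.
  + intros s; cnt.
- transitivity (-1 * int (fun u => V t u * (V t u + 2 * PI / L t) * v t u)).
  + rewrite <- int_scal by (cnt; first [kleaf | exact (kVt _)]).
    apply int_ext; intros u; ring.
  + ring_R.
Qed.

(** * Turning number, area and orientation *)

Let turning t := int (om t).

(** At each time the total curvature is a multiple of [2 * PI]; differentiation under the integral
    sign supplies its continuity in time. *)
Let turning_const : exists k : Z, forall t, 0 < t -> turning t = 2 * PI * IZR k.
Proof.
assert (Z : forall t, 0 < t -> exists k : Z, turning t = 2 * PI * IZR k).
{ intros t Ht; apply (turning_number _ _ _ _ _ _ (Cu t (Rlt_le _ _ Ht))). }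
destruct (Z 1 Rlt_0_1) as [k Hk]; exists k; intros t Ht; rewrite <- Hk.
apply quantized_constant; auto; [|lra].
intros s Hs; apply (ex_derive_continuous (V := R_NormedModule)); eexists.
apply (is_derive_int_param om (fun s u =>
   ((xut s u * yuu s u + xu s u * yuut s u
     - (yut s u * xuu s u + yu s u * xuut s u)) * v s u ^ 2
    - (xu s u * yuu s u - yu s u * xuu s u)
      * (2 * (xu s u * xut s u + yu s u * yut s u))) / (v s u ^ 2) ^ 2)); auto.
- intros r u Hr; assert (Hv := v_neq r u (Rlt_le _ _ Hr)).
  unfold om; eapply is_derive_value.
  + apply is_derive_Rdiv; [der|apply is_derive_Rpow, dv; auto|].
    now apply pow_nonzero.
  + simpl INR; simpl pred; cbv beta; field; auto.
- intros r u Hr; cnt; cbn [fst snd]; apply Rgt_not_eq, pow_lt, pow_lt, v_pos; lra.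
- intros r Hr; apply kom; lra.
Qed.

Let int_V t : 0 < t -> int (fun u => V t u * v t u) = sg t * turning t - 2 * PI.
Proof.
intros Ht; assert (Ht' := Rlt_le _ _ Ht).
rewrite (int_ext _ (fun u => sg t * om t u - 2 * PI / L t * v t u)).
- rewrite int_minus, !int_scal by (cnt; first [kleaf | exact (kom _ Ht' _)]).
  fold (L t) (turning t). pose proof (L_pos t Ht').
  field_R; lra.
- intros u; unfold V; field; split; [|apply v_neq; auto].
  apply Rgt_not_eq, L_pos; lra.
Qed.

(** Half the derivative of [q], written with the velocity so that it is visibly continuous in time
    even where [sg] might jump. *)
Let g t := int (fun u => xt t u * yu t u - yt t u * xu t u).

Let g_eq t : 0 < t -> g t = 2 * PI * sg t - turning t.
Proof.
intros Ht; assert (Ht' := Rlt_le _ _ Ht).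
unfold g; rewrite (int_ext _ (fun u => - sg t * (V t u * v t u))).
- rewrite int_scal by (cnt; first [kleaf | exact (kV _ Ht' _)]).
  rewrite int_V by auto.
  eq_R; transitivity (2 * PI * sg t - sg t ^ 2 * turning t); [ring|rewrite sg2; ring].
- intros u; destruct (flow t u Ht') as [-> ->].
  transitivity (- sg t * V t u * ((xu t u ^ 2 + yu t u ^ 2) / v t u));
    [field; auto|]. rewrite <- v2; field; auto.
Qed.

Let q_derive t : 0 < t -> is_derive q t (2 * g t).
Proof.
intros Ht; eapply is_derive_value.
- apply (is_derive_int_param (fun s u => x s u * yu s u - y s u * xu s u)
    (fun s u => xt s u * yu s u + x s u * yut s u
      - (yt s u * xu s u + y s u * xut s u))); auto.
  + intros s u Hs; derive_by; reflexivity.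
  + intros s u Hs; cnt.
  + intros s Hs; cnt; kleaf.
- destruct (velocity_ends t Ht) as [pxt pyt].
  assert (px : x t 1 = x t 0) by (rewrite <- (Rplus_0_l 1); apply F; lra).
  assert (py : y t 1 = y t 0) by (rewrite <- (Rplus_0_l 1); apply F; lra).
  (* The integrand is the [u]-derivative of the periodic function [x * yt - y * xt], by equality of
     mixed derivatives; subtracting it removes the [u]-derivatives of the velocity. *)
  assert (H : int (fun u => xu t u * yt t u + x t u * yut t u
     - (yu t u * xt t u + y t u * xut t u)) = 0).
  { rewrite (int_derive (fun u => x t u * yt t u - y t u * xt t u)).
    - rewrite pxt, pyt, px, py.
      ring_R.
    - intros u; unfold yut, yu at 2, xut, xu at 2.
      rewrite (smooth2_Schwarz x Sx), (smooth2_Schwarz y Sy).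
      eapply is_derive_value; [apply is_derive_Rminus; apply is_derive_Rmult;
        apply smooth2_is_derive_u; auto|reflexivity].
    - cnt; kleaf. }
  transitivity (int (fun u => 2 * (xt t u * yu t u - yt t u * xu t u))
    + int (fun u => xu t u * yt t u + x t u * yut t u
     - (yu t u * xt t u + y t u * xut t u))).
  + rewrite <- int_plus by (cnt; kleaf). apply int_ext; intros u; ring.
  + rewrite int_scal, H by (cnt; kleaf). unfold g; ring_R.
Qed.


(** By [g_eq] the continuous function [g] equals [2 * PI * sg - turning], a multiple of [2 * PI], so
    it is constant; [turning] being constant, so is [sg]. Continuity of the area alone would not
    exclude a change of sign. *)
Let orientation_const : exists s, (s = 1 \/ s = -1) /\
  forall t, 0 < t -> sg t = s.
Proof.
destruct turning_const as [k Hk]; exists (sg 1); split; [apply sg_cases|].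
intros t Ht; pose proof PI_RGT_0 as HPI.
assert (H : g t = g 1).
{ apply quantized_constant; auto; [| |lra].
  - intros s Hs; apply (ex_derive_continuous (V := R_NormedModule)); eexists.
    apply (is_derive_int_param (fun s u => xt s u * yu s u - yt s u * xu s u)
      (fun s u => xtt s u * yu s u + xt s u * yut s u
        - (ytt s u * xu s u + yt s u * xut s u))); auto.
    + intros r u Hr; derive_by; reflexivity.
    + intros r u Hr; cnt.
    + intros r Hr; cnt; kleaf.
  - intros s Hs; rewrite g_eq, Hk by auto.
    destruct (sg_cases s) as [-> | ->].
    + exists (1 - k)%Z; rewrite minus_IZR; ring.
    + exists (-1 - k)%Z; rewrite minus_IZR; ring. }
rewrite !g_eq, !Hk in H by lra; nra.
Qed.

(* Cauchy-Schwarz, in the form [om^2 / v >= 2 m om - m^2 v] with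
   [m = 2 pi k / L]; then [k^2 >= k s] because [k] is an integer. *)
Let length_nonincreasing t : 1 <= t -> L t <= L 1.
Proof.
intros Ht; destruct turning_const as [k Hk]; pose proof PI_RGT_0 as HPI.
apply (nonincreasing_of_derive L
  (fun s => - int (fun u => V s u * (V s u + 2 * PI / L s) * v s u))); auto.
{ intros r Hr; apply length_derive; lra. }
intros s Hs; assert (Hs' : 0 <= s) by lra.
assert (kVs := kV s Hs'); assert (koms := kom s Hs'); pose proof (L_pos s Hs') as HL.
set (m := 2 * PI * IZR k / L s).
assert (H : int (fun u => 2 * m * om s u - m ^ 2 * v s u
   - 2 * PI / L s * sg s * om s u)
  <= int (fun u => V s u * (V s u + 2 * PI / L s) * v s u)).
{ apply int_le; [lra| | |].
  - cnt; first [kleaf | exact (koms _)].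
  - cnt; first [kleaf | exact (kVs _)].
  - intros u; pose proof (v_pos s u Hs').
    assert (E1 : V s u * (V s u + 2 * PI / L s) * v s u
      - (2 * m * om s u - m ^ 2 * v s u - 2 * PI / L s * sg s * om s u)
      = (om s u / v s u - m) ^ 2 * v s u).
    { unfold V; transitivity (sg s ^ 2 * om s u ^ 2 / v s u - 2 * m * om s u
        + m ^ 2 * v s u); [field; lra|rewrite sg2; field; lra]. }
    assert (0 <= (om s u / v s u - m) ^ 2 * v s u)
      by (apply Rmult_le_pos; [apply pow2_ge_0|lra]).
    lra. }
rewrite 2!int_minus, !int_scal in H by (cnt; first [kleaf | exact (koms _)]).
fold (turning s) (L s) in H; rewrite Hk in H by lra.
assert (Hk2 : 0 <= IZR k ^ 2 - sg s * IZR k).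
{ destruct (sg_cases s) as [-> | ->].
  - replace (IZR k ^ 2 - 1 * IZR k) with (IZR (k * (k - 1)))
      by (rewrite mult_IZR, minus_IZR; ring). apply IZR_le; nia.
  - replace (IZR k ^ 2 - -1 * IZR k) with (IZR (k * (k + 1)))
      by (rewrite mult_IZR, plus_IZR; ring). apply IZR_le; nia. }
replace (2 * m * (2 * PI * IZR k) - m ^ 2 * L s
  - 2 * PI / L s * sg s * (2 * PI * IZR k))
  with (4 * PI ^ 2 * (IZR k ^ 2 - sg s * IZR k) / L s) in H
  by (unfold m; field; lra).
assert (0 <= 4 * PI ^ 2 * (IZR k ^ 2 - sg s * IZR k) / L s).
{ apply Rdiv_le_0_compat; auto. apply Rmult_le_pos; auto.
  pose proof (pow2_ge_0 PI); lra. }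
lra.
Qed.

Let q_bound t : 1 <= t -> 2 * PI * Rabs (q t) <= L 1 ^ 2.
Proof.
intros Ht; assert (Ht' : 0 <= t) by lra.
pose proof (isoperimetric _ _ _ _ _ _ (Cu t Ht') 1 ltac:(ring)) as H1.
pose proof (isoperimetric _ _ _ _ _ _ (Cu t Ht') (-1) ltac:(ring)) as H2.
fold (v t) in H1, H2; fold (L t) in H1, H2; fold (q t) in H1, H2.
pose proof (length_nonincreasing t Ht); pose proof (L_pos t Ht').
assert (L t ^ 2 <= L 1 ^ 2) by (apply pow_incr; lra).
unfold Rabs; destruct Rcase_abs; lra.
Qed.

(* Otherwise the area would grow linearly, against the isoperimetric bound. *)
Let turning_orientation : exists s, (s = 1 \/ s = -1) /\
  forall t, 0 < t -> sg t = s /\ turning t = 2 * PI * s.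
Proof.
destruct orientation_const as [s [Hs Hsg]]; exists s; split; auto.
destruct turning_const as [k Hk]; pose proof PI_RGT_0 as HPI.
intros t Ht; split; auto. rewrite Hk by auto.
destruct (Req_dec (IZR k) s) as [->|N]; auto; exfalso.
set (c := 4 * PI * (s - IZR k)).
assert (Hq : forall t, 0 < t -> is_derive q t c).
{ intros r Hr; eapply is_derive_value; [now apply q_derive|].
  rewrite g_eq, Hsg, Hk by auto; unfold c; ring. }
assert (Hlin : forall t, 1 <= t -> q t = q 1 + c * (t - 1)).
{ intros r Hr.
  pose proof (nonincreasing_of_derive (fun z => q z - c * z) (fun _ => 0) 1 r Hr
    ltac:(intros z Hz; eapply is_derive_value;
      [apply (is_derive_Rminus q (fun z => c * z)); [apply Hq; lra|der]|cbv beta; ring])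
    ltac:(intros; lra)) as H1.
  pose proof (nonincreasing_of_derive (fun z => c * z - q z) (fun _ => 0) 1 r Hr
    ltac:(intros z Hz; eapply is_derive_value;
      [apply (is_derive_Rminus (fun z => c * z) q); [der|apply Hq; lra]|cbv beta; ring])
    ltac:(intros; lra)) as H2.
  cbv beta in H1, H2; lra. }
assert (Hc : 1 <= Rabs c).
{ unfold c; rewrite Rabs_mult, (Rabs_right (4 * PI)) by lra.
  assert (1 <= Rabs (s - IZR k)).
  { assert (Z : exists z : Z, s = IZR z) by (destruct Hs as [-> | ->]; eauto).
    destruct Z as [z ->]; rewrite <- minus_IZR, <- abs_IZR; apply IZR_le.
    assert (z <> k) by (intros ->; auto). lia. }
  pose proof PI2_1; nra. }
(* By this time the slope [|c| >= 1] makes [|q t1|] at least [L 1 ^ 2], whereas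
   [2 * PI * |q t1| <= L 1 ^ 2]. *)
set (t1 := 1 + L 1 ^ 2 + Rabs (q 1)).
assert (H1 : 1 <= t1).
{ pose proof (Rabs_pos (q 1)); pose proof (pow2_ge_0 (L 1)); unfold t1; lra. }
pose proof (q_bound t1 H1) as H2; pose proof (q_bound 1 (Rle_refl 1)) as H3.
rewrite (Hlin t1 H1) in H2.
pose proof (Rabs_triang (q 1 + c * (t1 - 1)) (- q 1)) as H4.
replace (q 1 + c * (t1 - 1) + - q 1) with (c * (t1 - 1)) in H4 by ring.
rewrite Rabs_Ropp, Rabs_mult, (Rabs_right (t1 - 1)) in H4 by lra.
assert (t1 - 1 <= Rabs c * (t1 - 1)) by nra.
pose proof (L_pos 1 Rle_0_1). assert (0 < L 1 ^ 2) by (apply pow_lt; auto).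
pose proof (Rabs_pos (q 1 + c * (t1 - 1))); pose proof PI2_1.
replace (t1 - 1) with (L 1 ^ 2 + Rabs (q 1)) in * by (unfold t1; ring).
nra.
Qed.

(** * Decay of the isoperimetric deficit *)

Section Aligned.
Variable s : R.
Hypothesis s_cases : s = 1 \/ s = -1.
Hypothesis aligned : forall t, 0 < t -> sg t = s /\ turning t = 2 * PI * s.

Let s2 : s ^ 2 = 1.
Proof. destruct s_cases as [-> | ->]; ring. Qed.

Let D t := L t ^ 2 - 2 * PI * s * q t.

Let int_V0 t : 0 < t -> int (fun u => V t u * v t u) = 0.
Proof.
intros Ht; rewrite int_V by auto; destruct (aligned t Ht) as [-> ->].
transitivity (2 * PI * (s ^ 2 - 1)); [ring|rewrite s2; ring].
Qed.

Let int_curvature_V t : 0 < t ->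
  int (fun u => V t u * (V t u + 2 * PI / L t) * v t u) = E t.
Proof.
intros Ht; assert (kVt := kV t (Rlt_le _ _ Ht)).
rewrite (int_ext _ (fun u => V t u ^ 2 * v t u + 2 * PI / L t * (V t u * v t u)))
  by (intros u; ring).
rewrite int_plus, int_scal, int_V0 by (auto; cnt; first [kleaf | exact (kVt _)]).
fold (E t); ring_R.
Qed.

Let E_ge0 t : 0 < t -> 0 <= E t.
Proof.
intros Ht; assert (kVt := kV t (Rlt_le _ _ Ht)).
apply int_ge0; [lra|cnt; first [kleaf | exact (kVt _)]|].
intros u; apply Rmult_le_pos; [apply pow2_ge_0|apply Rlt_le, v_pos; lra].
Qed.

Let dL t : 0 < t -> is_derive L t (- E t).
Proof. intros Ht; rewrite <- int_curvature_V by auto; now apply length_derive. Qed.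

Let dq t : 0 < t -> is_derive q t 0.
Proof.
intros Ht; eapply is_derive_value; [now apply q_derive|].
rewrite g_eq by auto; destruct (aligned t Ht) as [-> ->]; ring.
Qed.

Let q_const t : 1 <= t -> q t = q 1.
Proof.
intros Ht.
pose proof (nonincreasing_of_derive q (fun _ => 0) 1 t Ht
  ltac:(intros; apply dq; lra) ltac:(intros; lra)).
pose proof (nonincreasing_of_derive (fun r => - q r) (fun _ => 0) 1 t Ht
  ltac:(intros z Hz; eapply is_derive_value;
    [apply is_derive_Ropp, dq; lra|ring]) ltac:(intros; lra)).
cbv beta in *; lra.
Qed.

Let dD t : 0 < t -> is_derive D t (- (2 * L t * E t)).
Proof.
intros Ht; unfold D; eapply is_derive_value.
- apply is_derive_Rminus; [apply is_derive_Rpow, dL; auto|].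
  apply (is_derive_Rmult (fun _ => 2 * PI * s) q); [der|now apply dq].
- simpl INR; simpl pred; ring.
Qed.

Let D_ge0 t : 0 < t -> 0 <= D t.
Proof.
intros Ht; exact (isoperimetric _ _ _ _ _ _ (Cu t (Rlt_le _ _ Ht)) s s2).
Qed.

Let D_le_E t : 0 < t -> D t <= L t ^ 3 / (2 * PI ^ 2) * E t.
Proof.
intros Ht.
assert (EV : forall u, V t u = s * om t u / v t u - 2 * PI / L t)
  by (intros u; unfold V; now rewrite (proj1 (aligned t Ht))).
unfold E; rewrite (int_ext _ (fun u => (s * om t u / v t u - 2 * PI / L t) ^ 2
  * v t u)) by (intros u; now rewrite EV).
apply (deficit_le_energy _ _ _ _ _ _ (Cu t (Rlt_le _ _ Ht)) s s2).
fold (v t); fold (L t).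
transitivity (int (fun u => V t u * v t u)); [|now apply int_V0].
apply int_ext; intros u; now rewrite EV.
Qed.

Let L_anti r t : 1 <= r -> r <= t -> L t <= L r.
Proof.
intros Hr Ht; apply (nonincreasing_of_derive L (fun t => - E t)); auto.
- intros z Hz; apply dL; lra.
- intros z Hz; pose proof (E_ge0 z ltac:(lra)); lra.
Qed.

(* With zero area, [D = L^2] and [(L^2)' = - 2 L E <= - 4 pi^2]: the curve
   would shrink to a point in finite time. *)
Let area_pos : 0 < s * q 1.
Proof.
pose proof PI2_1 as HPI.
(* The orientation is read from the sign of the area, so [s * q 1] is nonnegative and only the value
   zero has to be excluded. *)
pose proof (sg_q 1) as H0; rewrite (proj1 (aligned 1 Rlt_0_1)) in H0.
destruct H0 as [|H0]; auto; exfalso.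
assert (HE : forall t, 1 <= t -> 2 * PI ^ 2 <= L t * E t).
{ intros t Ht; pose proof (D_le_E t ltac:(lra)) as H; pose proof (L_pos t ltac:(lra)).
  unfold D in H; rewrite q_const in H by auto.
  replace (2 * PI * s * q 1) with (2 * PI * (s * q 1)) in H by ring.
  rewrite <- H0, Rmult_0_r, Rminus_0_r in H.
  assert (0 < PI ^ 2) by (apply pow_lt; lra).
  assert (0 < L t ^ 2) by (apply pow_lt; lra).
  replace (L t ^ 3 / (2 * PI ^ 2) * E t)
    with (L t ^ 2 * (L t * E t / (2 * PI ^ 2))) in H by (field; lra).
  assert (1 <= L t * E t / (2 * PI ^ 2)).
  { apply (Rmult_le_reg_l (L t ^ 2)); lra. }
  replace (L t * E t) with (L t * E t / (2 * PI ^ 2) * (2 * PI ^ 2)) by (field; lra).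
  nra. }
pose proof (L_pos 1 Rle_0_1) as HL1; assert (HL2 : 0 < L 1 ^ 2) by (apply pow_lt; lra).
(* [L ^ 2] loses at least [4 * PI ^ 2] per unit of time, so it would be negative at [t1]. *)
set (t1 := 1 + L 1 ^ 2).
pose proof (nonincreasing_of_derive (fun t => L t ^ 2 + 4 * PI ^ 2 * t)
  (fun t => 2 * - E t * L t + 4 * PI ^ 2) 1 t1 ltac:(unfold t1; lra)) as H.
cbv beta in H.
assert (L t1 ^ 2 + 4 * PI ^ 2 * t1 <= L 1 ^ 2 + 4 * PI ^ 2 * 1).
{ apply H.
  - intros r Hr; eapply is_derive_value.
    + apply (is_derive_Rplus (fun t => L t ^ 2) (fun t => 4 * PI ^ 2 * t)).
      * apply is_derive_Rpow, dL; lra.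
      * apply (is_derive_Rmult (fun _ => 4 * PI ^ 2) (fun t => t)); der.
    + simpl INR; simpl (Init.Nat.pred 2); ring.
  - intros r Hr; specialize (HE r (proj1 Hr)); lra. }
pose proof (pow2_ge_0 (L t1)).
assert (4 <= PI ^ 2) by nra.
assert (4 * PI ^ 2 * L 1 ^ 2 <= L 1 ^ 2) by (unfold t1 in *; lra).
nra.
Qed.

Let L2_ge t : 1 <= t -> 2 * PI * (s * q 1) <= L t ^ 2.
Proof.
intros Ht; pose proof (D_ge0 t ltac:(lra)) as H; unfold D in H.
rewrite q_const in H by auto; lra.
Qed.

(** [D_le_E] and [L <= L 1] give [L * E >= a * D], so [D' = - 2 * L * E] would allow the rate
    [2 * a]. Taking [a] leaves the term [exp (a * t) * L * E] to spare in [dG_le], and that term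
    pays for the motion of the centre. *)
Let a := 2 * PI ^ 2 / L 1 ^ 2.

Let a_pos : 0 < a.
Proof.
pose proof PI_RGT_0; apply Rdiv_lt_0_compat; [|apply pow_lt, L_pos; lra].
apply Rmult_lt_0_compat; [lra|apply pow_lt; lra].
Qed.

Let G t := exp (a * t) * D t.
Let dG t := a * exp (a * t) * D t - 2 * exp (a * t) * L t * E t.

Let G_derive t : 0 < t -> is_derive G t (dG t).
Proof.
intros Ht; unfold G, dG; eapply is_derive_value.
- apply is_derive_Rmult; [|now apply dD].
  apply (is_derive_after (fun r => a * r) t a) with (h := exp).
  + eapply is_derive_value;
      [apply (is_derive_Rmult (fun _ => a) (fun r => r)); der|cbv beta; ring].
  + apply is_derive_exp.
- cbv beta; ring.
Qed.

Let dG_le t : 1 <= t -> dG t <= - (exp (a * t) * L t * E t).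
Proof.
intros Ht; unfold dG.
enough (exp (a * t) * (a * D t) <= exp (a * t) * (L t * E t)) by lra.
apply Rmult_le_compat_l; [apply Rlt_le, exp_pos|].
pose proof (D_le_E t ltac:(lra)) as H; pose proof (E_ge0 t ltac:(lra)) as HE.
pose proof (L_anti 1 t ltac:(lra) Ht) as HL; pose proof (L_pos t ltac:(lra)).
pose proof (L_pos 1 ltac:(lra)); pose proof PI_RGT_0 as HPI.
apply Rle_trans with (a * (L t ^ 3 / (2 * PI ^ 2) * E t)).
{ apply Rmult_le_compat_l; lra. }
unfold a; replace (2 * PI ^ 2 / L 1 ^ 2 * (L t ^ 3 / (2 * PI ^ 2) * E t))
  with ((L t / L 1) ^ 2 * (L t * E t)) by (field; lra).
assert (0 <= L t / L 1 <= 1).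
{ split; [apply Rdiv_le_0_compat; lra|].
  apply (Rmult_le_reg_r (L 1)); [lra|].
  unfold Rdiv; rewrite Rmult_assoc, Rinv_l; lra. }
assert (0 <= L t * E t) by (apply Rmult_le_pos; lra).
assert ((L t / L 1) ^ 2 <= 1) by nra.
nra.
Qed.

(** [G] does not increase and [exp (a * t) >= a * t], so [a * t * D t <= G 1]; this dictates the
    threshold in time. *)
Let deficit_tends_to : tends_to D 0.
Proof.
intros eps He; exists (Rmax 1 (G 1 / (a * eps) + 1)); intros t Ht.
pose proof (Rmax_l 1 (G 1 / (a * eps) + 1)); pose proof (Rmax_r 1 (G 1 / (a * eps) + 1)).
pose proof (D_ge0 t ltac:(lra)).
rewrite Rminus_0_r, Rabs_right by lra.
assert (HG : G t <= G 1).
{ apply (nonincreasing_of_derive G dG); [lra| |].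
  - intros r Hr; apply G_derive; lra.
  - intros r Hr; pose proof (dG_le r (proj1 Hr)) as H2.
    pose proof (E_ge0 r ltac:(lra)); pose proof (L_pos r ltac:(lra)).
    pose proof (exp_pos (a * r)).
    assert (0 <= exp (a * r) * L r * E r)
      by (apply Rmult_le_pos; [apply Rmult_le_pos; lra|lra]).
    lra. }
assert (Hat : 0 < a * t) by (apply Rmult_lt_0_compat; lra).
assert (HD : a * t * D t <= G 1).
{ eapply Rle_trans; [|exact HG]; apply Rmult_le_compat_r; auto.
  pose proof (exp_ineq1_le (a * t)); lra. }
apply Rnot_le_lt; intros N.
assert (a * t * eps <= G 1) by nra.
assert (a * eps * (G 1 / (a * eps) + 1) <= a * eps * t)
  by (apply Rmult_le_compat_l; [apply Rmult_le_pos; lra|lra]).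
replace (a * eps * (G 1 / (a * eps) + 1)) with (G 1 + a * eps) in * by (field; lra).
assert (0 < a * eps) by (apply Rmult_lt_0_compat; lra). lra.
Qed.

Let length_tends_to : exists l, 0 < l /\ tends_to L l.
Proof.
pose proof PI_RGT_0 as HPI.
assert (HA : 0 < 2 * PI * (s * q 1)) by (apply Rmult_lt_0_compat; [lra|apply area_pos]).
destruct (nonincreasing_tends_to L (sqrt (2 * PI * (s * q 1)))) as [l [Hl Ht]].
- apply L_anti.
- intros t Ht; rewrite <- (sqrt_pow2 (L t)) by (apply Rlt_le, L_pos; lra).
  now apply sqrt_le_1_alt, L2_ge.
- exists l; split; auto. pose proof (sqrt_lt_R0 _ HA); lra.
Qed.

(** * Convergence of the centre of mass *)

Let center (h : R -> R -> R) t := int (fun u => h t u * v t u) / L t.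

(* [|c'| <= C1 sqrt E + C2 E] with [sqrt E <= (e^(a t) E + e^(- a t)) / 2], and
   the right-hand side is dominated by minus the derivative of a combination of
   [L], [e^(a t) D] and [e^(- a t)]. *)
Let center_tends_to h ht :
  (forall t u, is_derive (fun s => h s u) t (ht t u)) ->
  (forall t u, continuous (fun p => h (fst p) (snd p)) (t, u)) ->
  (forall t u, continuous (fun p => ht (fst p) (snd p)) (t, u)) ->
  (forall t, cont (h t)) -> (forall t, cont (ht t)) ->
  (forall t u, 0 < t -> Rabs (ht t u) <= Rabs (V t u)) ->
  (forall t u, 1 <= t -> Rabs (h t u - center h t) <= 13 * L t) ->
  exists l, tends_to (center h) l.
Proof.
intros d_h c_h c_ht k_h k_ht Hht Hh; pose proof PI_RGT_0 as HPI.
set (A := 2 * PI * (s * q 1)).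
assert (HA : 0 < A) by (apply Rmult_lt_0_compat; [lra|apply area_pos]).
(* The 1 comes from the velocity [ht], and [26 * PI] from the bound [13 * L] times the constant
   [2 * PI / L] in the curvature. *)
set (K := 1 + 26 * PI).
set (I t := int (fun u => ht t u * v t u
              - h t u * (V t u * (V t u + 2 * PI / L t) * v t u))).
apply (tends_to_of_derive_bound (center h)
  (fun t => (I t * L t - int (fun u => h t u * v t u) * - E t) / L t ^ 2)
  (fun t => 13 * L t + K / (2 * A) * G t + K / (2 * a) * exp (- a * t))
  (fun t => 13 * - E t + K / (2 * A) * dG t + K / (2 * a) * (- a * exp (- a * t)))).
- intros t Ht; unfold center.
  apply (is_derive_Rdiv (fun t => int (fun u => h t u * v t u)) L).
  + now apply weighted_length_derive.
  + now apply dL.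
  + apply Rgt_not_eq, L_pos; lra.
- intros t Ht; apply is_derive_Rplus; [apply is_derive_Rplus|].
  + eapply is_derive_value;
      [apply (is_derive_Rmult (fun _ => 13) L); [der|now apply dL]|ring].
  + eapply is_derive_value;
      [apply (is_derive_Rmult (fun _ => K / (2 * A)) G); [der|now apply G_derive]|ring].
  + eapply is_derive_value;
      [apply (is_derive_Rmult (fun _ => K / (2 * a)) (fun t => exp (- a * t))); [der|]|].
    * apply (is_derive_after (fun r => - a * r) t (- a)) with (h := exp);
        [|apply is_derive_exp].
      eapply is_derive_value;
        [apply (is_derive_Rmult (fun _ => - a) (fun r => r)); der|cbv beta; ring].
    * cbv beta; ring.
- intros t Ht; assert (Ht0 : 0 < t) by lra; assert (Ht1 : 0 <= t) by lra.
  assert (kVt := kV t Ht1); pose proof (L_pos t Ht1) as HL.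
  pose proof (E_ge0 t Ht0) as HE.
  set (z := exp (a * t)); assert (Hz : 0 < z) by apply exp_pos.
  replace (exp (- a * t)) with (/ z)
    by (unfold z; rewrite <- exp_Ropp; f_equal; ring).
  set (c := center h t).
  (* Since [L'] is minus the integral of curvature times [V], the quotient rule amounts to measuring
     [h] from its own centre, where it is bounded by a multiple of [L]. *)
  assert (EI : (I t * L t - int (fun u => h t u * v t u) * - E t) / L t ^ 2
    = / L t * int (fun u => ht t u * v t u
        - (h t u - c) * (V t u * (V t u + 2 * PI / L t) * v t u))).
  { rewrite (int_ext (fun u => ht t u * v t u - (h t u - c) * _)
      (fun u => (ht t u * v t u - h t u * (V t u * (V t u + 2 * PI / L t) * v t u))
         + c * (V t u * (V t u + 2 * PI / L t) * v t u))) by (intros u; ring).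
    rewrite int_plus, int_scal, int_curvature_V
      by (auto; cnt; first [kleaf | exact (kVt _) | exact (k_h t _) | exact (k_ht t _)]).
    fold (I t); unfold c, center; field; lra. }
  rewrite EI, Rabs_mult, (Rabs_right (/ L t))
    by (apply Rgt_ge, Rlt_gt, Rinv_0_lt_compat; lra).
  apply Rle_trans with (/ L t * (K / 2 * (z * E t + / z * L t) + 13 * L t * E t)).
  { apply Rmult_le_compat_l; [apply Rlt_le, Rinv_0_lt_compat; lra|].
    assert (kf : cont (fun u => ht t u * v t u
        - (h t u - c) * (V t u * (V t u + 2 * PI / L t) * v t u)))
      by (cnt; first [kleaf | exact (kVt _) | exact (k_h t _) | exact (k_ht t _)]).
    eapply Rle_trans; [apply int_abs_le; [lra|exact kf]|].
    replace (K / 2 * (z * E t + / z * L t) + 13 * L t * E t) with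
      (int (fun u => (K / 2 * z + 13 * L t) * (V t u ^ 2 * v t u)
                     + K / 2 * / z * v t u)).
    2:{ rewrite int_plus, !int_scal by (cnt; first [kleaf | exact (kVt _)]).
        fold (E t) (L t); ring_R. }
    apply int_le; [lra| | |].
    { intros u; apply (continuous_after Rabs); [apply kf|apply continuous_Rabs]. }
    { cnt; first [kleaf | exact (kVt _)]. }
    intros u; pose proof (v_pos t u Ht1) as Hv.
    replace (ht t u * v t u - (h t u - c) * (V t u * (V t u + 2 * PI / L t) * v t u))
      with ((ht t u - (h t u - c) * (V t u ^ 2 + 2 * PI / L t * V t u)) * v t u) by ring.
    replace ((K / 2 * z + 13 * L t) * (V t u ^ 2 * v t u) + K / 2 * / z * v t u)
      with (((K / 2 * z + 13 * L t) * V t u ^ 2 + K / 2 * / z) * v t u) by ring.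
    rewrite Rabs_mult, (Rabs_right (v t u)) by lra.
    apply Rmult_le_compat_r; [lra|].
    specialize (Hht t u Ht0); specialize (Hh t u Ht); fold c in Hh.
    set (X := Rabs (V t u)) in *; assert (HX : 0 <= X) by apply Rabs_pos.
    replace (V t u ^ 2) with (X ^ 2) by apply pow2_abs.
    assert (Hw : 0 < 2 * PI / L t) by (apply Rdiv_lt_0_compat; lra).
    assert (H1 : Rabs (X ^ 2 + 2 * PI / L t * V t u) <= X ^ 2 + 2 * PI / L t * X).
    { eapply Rle_trans; [apply Rabs_triang|].
      rewrite (Rabs_right (X ^ 2)) by (apply Rle_ge, pow2_ge_0).
      rewrite Rabs_mult, (Rabs_right (2 * PI / L t)) by lra. fold X; lra. }
    assert (H2 : Rabs ((h t u - c) * (X ^ 2 + 2 * PI / L t * V t u))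
       <= 13 * L t * (X ^ 2 + 2 * PI / L t * X)).
    { rewrite Rabs_mult; apply Rmult_le_compat; auto; apply Rabs_pos. }
    replace (13 * L t * (X ^ 2 + 2 * PI / L t * X))
      with (13 * L t * X ^ 2 + 26 * PI * X) in H2 by (field; lra).
    assert (H3 : X <= / 2 * (z * X ^ 2 + / z)).
    { assert (0 <= / z * (z * X - 1) ^ 2)
        by (apply Rmult_le_pos; [apply Rlt_le, Rinv_0_lt_compat; lra|apply pow2_ge_0]).
      replace (/ z * (z * X - 1) ^ 2) with (z * X ^ 2 + / z - 2 * X) in *
        by (field; lra). lra. }
    assert (HK : 0 < K) by (unfold K; lra).
    assert (H4 : K * X <= K * (/ 2 * (z * X ^ 2 + / z)))
      by (apply Rmult_le_compat_l; lra).
    unfold Rminus at 1; eapply Rle_trans; [apply Rabs_triang|].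
    rewrite Rabs_Ropp; unfold K at 1 in H4; lra. }
  pose proof (dG_le t Ht) as H; fold z in H.
  assert (HK : 0 < K) by (unfold K; lra).
  assert (HKA : 0 < K / (2 * A)) by (apply Rdiv_lt_0_compat; lra).
  assert (H1 : K / (2 * A) * dG t <= K / (2 * A) * - (z * L t * E t))
    by (apply Rmult_le_compat_l; lra).
  (* The area bound [A <= L ^ 2] trades the factor [/ L] for the factor [L / A] that [dG]
     provides. *)
  assert (H2 : K / 2 * z * E t / L t <= K / (2 * A) * (z * L t * E t)).
  { pose proof (L2_ge t Ht) as H3; fold A in H3.
    assert (0 <= K / 2 * z * E t)
      by (apply Rmult_le_pos; [apply Rmult_le_pos; lra|lra]).
    replace (K / (2 * A) * (z * L t * E t))
      with (K / 2 * z * E t / L t * (L t ^ 2 / A)) by (field; lra).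
    assert (1 <= L t ^ 2 / A).
    { apply (Rmult_le_reg_r A); auto. unfold Rdiv; rewrite Rmult_assoc, Rinv_l; lra. }
    assert (0 <= K / 2 * z * E t / L t) by (apply Rdiv_le_0_compat; lra).
    nra. }
  replace (/ L t * (K / 2 * (z * E t + / z * L t) + 13 * L t * E t))
    with (K / 2 * z * E t / L t + K / 2 * / z + 13 * E t) by (field; lra).
  replace (K / (2 * a) * (- a * / z)) with (- (K / 2 * / z))
    by (field; split; lra).
  lra.
- intros t Ht; pose proof (L_pos t ltac:(lra)).
  assert (0 <= G t)
    by (apply Rmult_le_pos; [apply Rlt_le, exp_pos|apply D_ge0; lra]).
  assert (0 < K) by (unfold K; lra).
  assert (0 < K / (2 * A)) by (apply Rdiv_lt_0_compat; lra).
  assert (0 < K / (2 * a)) by (apply Rdiv_lt_0_compat; lra).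
  pose proof (exp_pos (- a * t)).
  assert (0 <= K / (2 * A) * G t) by (apply Rmult_le_pos; lra).
  assert (0 <= K / (2 * a) * exp (- a * t)) by (apply Rmult_le_pos; lra).
  lra.
Qed.

(** * Hausdorff convergence to a circle *)

Let near t : 0 < t -> exists al, forall u,
  let th := al + s * (2 * PI / L t * RInt (v t) 0 u) in
  Rabs (x t u - center x t - L t / (2 * PI) * cos th) <= 8 * sqrt (2 * D t) /\
  Rabs (y t u - center y t - L t / (2 * PI) * sin th) <= 8 * sqrt (2 * D t).
Proof.
intros Ht.
destruct (near_circle _ _ _ _ _ _ (Cu t (Rlt_le _ _ Ht)) s s2) as [al Hal].
exists al; intros u; cbv zeta; specialize (Hal u).
fold (v t) in Hal; fold (L t) in Hal; fold (q t) in Hal; fold (D t) in Hal.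
set (ph := 2 * PI / L t * RInt (v t) 0 u : R) in *.
replace (cos (al + s * ph)) with (cos al * cos ph - s * sin al * sin ph).
2:{ destruct s_cases as [-> | ->].
    - rewrite !Rmult_1_l, cos_plus; ring.
    - replace (al + -1 * ph) with (al - ph) by ring; rewrite cos_minus; ring. }
replace (sin (al + s * ph)) with (s * cos al * sin ph + sin al * cos ph); [exact Hal|].
destruct s_cases as [-> | ->].
- rewrite !Rmult_1_l, sin_plus; ring.
- replace (al + -1 * ph) with (al - ph) by ring; rewrite sin_minus; ring.
Qed.

Let near_center t u : 1 <= t ->
  Rabs (x t u - center x t) <= 13 * L t /\ Rabs (y t u - center y t) <= 13 * L t.
Proof.
intros Ht; pose proof PI2_1 as HPI; pose proof (L_pos t ltac:(lra)) as HL.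
destruct (near t ltac:(lra)) as [al H]; specialize (H u); cbv zeta in H.
set (th := al + _) in H.
(* [s * q] is positive, so [D <= L ^ 2]; then [8 * (3 / 2) * L] plus the radius
   [L / (2 * PI) <= L / 4] stays below [13 * L]. *)
assert (HD : sqrt (2 * D t) <= 3 / 2 * L t).
{ rewrite <- (sqrt_pow2 (3 / 2 * L t)) by lra; apply sqrt_le_1_alt.
  assert (0 < 2 * PI * (s * q 1)) by (apply Rmult_lt_0_compat; [lra|apply area_pos]).
  unfold D; rewrite q_const by auto. pose proof (pow2_ge_0 (L t)). lra. }
assert (Hr : 0 <= L t / (2 * PI) <= / 4 * L t).
{ split; [apply Rdiv_le_0_compat; lra|].
  apply (Rmult_le_reg_r (2 * PI)); [lra|].
  replace (L t / (2 * PI) * (2 * PI)) with (L t) by (field; lra). nra. }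
assert (Hc : Rabs (cos th) <= 1) by (apply Rabs_le, COS_bound).
assert (Hs : Rabs (sin th) <= 1) by (apply Rabs_le, SIN_bound).
assert (B : forall p e, Rabs e <= 1 ->
  Rabs (p - L t / (2 * PI) * e) <= 8 * sqrt (2 * D t) -> Rabs p <= 13 * L t).
{ intros p e He Hp.
  replace p with (p - L t / (2 * PI) * e + L t / (2 * PI) * e) by ring.
  eapply Rle_trans; [apply Rabs_triang|].
  rewrite Rabs_mult, (Rabs_right (L t / (2 * PI))) by lra.
  pose proof (Rabs_pos e); nra. }
split; [apply (B _ (cos th))|apply (B _ (sin th))]; tauto.
Qed.

Lemma aligned_converges :
  exists c1 c2 r, 0 < r /\ converges_to_circle x y c1 c2 r.
Proof.
pose proof PI2_1 as HPI.
assert (Hn : forall t u, 0 < t -> Rabs (xt t u) <= Rabs (V t u) /\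
                                  Rabs (yt t u) <= Rabs (V t u)).
{ intros t u Ht; assert (Hv := v_pos t u (Rlt_le _ _ Ht)).
  destruct (flow t u (Rlt_le _ _ Ht)) as [-> ->]; rewrite !Rabs_mult.
  assert (B : forall p p', norm2 p p' = v t u -> Rabs (sg t * p / v t u) <= 1).
  { intros p p' E1; unfold Rdiv; rewrite !Rabs_mult, (Rabs_right (/ v t u))
      by (apply Rgt_ge, Rlt_gt, Rinv_0_lt_compat; lra).
    assert (Rabs (sg t) = 1) as ->.
    { destruct (sg_cases t) as [-> | ->]; [apply Rabs_R1|].
      now rewrite Rabs_left by lra; ring_simplify. }
    pose proof (abs_le_norm2 p p'); rewrite E1 in *.
    apply (Rmult_le_reg_r (v t u)); auto.
    rewrite Rmult_1_l, Rmult_assoc, Rinv_l; lra. }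
  assert (Ev : norm2 (- yu t u) (xu t u) = norm2 (xu t u) (yu t u))
    by (apply norm2_eq; ring).
  pose proof (B (- yu t u) (xu t u) Ev).
  pose proof (B (xu t u) (yu t u) eq_refl).
  pose proof (Rabs_pos (V t u)); split; nra. }
destruct (center_tends_to x xt) as [c1 Hc1]; auto.
{ intros t u Ht; apply Hn, Ht. }
{ intros t u Ht; now apply near_center. }
destruct (center_tends_to y yt) as [c2 Hc2]; auto.
{ intros t u Ht; apply Hn, Ht. }
{ intros t u Ht; now apply near_center. }
destruct length_tends_to as [l [Hl Hlt]].
exists c1, c2, (l / (2 * PI)); set (r := l / (2 * PI)).
assert (Hr : 0 < r) by (apply Rdiv_lt_0_compat; lra).
split; auto; intros eps He.
destruct (Hc1 (eps / 8)) as [T1 H1]; [lra|].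
destruct (Hc2 (eps / 8)) as [T2 H2]; [lra|].
destruct (tends_to_scal (/ (2 * PI)) _ _ Hlt (eps / 8)) as [T3 H3]; [lra|].
(* Tuned so that [8 * sqrt (2 * D t) <= eps / 8]. *)
destruct (deficit_tends_to (/ 2 * (eps / 64) ^ 2)) as [T4 H4].
{ apply Rmult_lt_0_compat; [lra|apply pow_lt; lra]. }
exists (Rmax 1 (Rmax (Rmax T1 T2) (Rmax T3 T4))); intros t Ht.
pose proof (Rmax_l 1 (Rmax (Rmax T1 T2) (Rmax T3 T4))).
pose proof (Rmax_r 1 (Rmax (Rmax T1 T2) (Rmax T3 T4))).
pose proof (Rmax_l (Rmax T1 T2) (Rmax T3 T4)).
pose proof (Rmax_r (Rmax T1 T2) (Rmax T3 T4)).
pose proof (Rmax_l T1 T2); pose proof (Rmax_r T1 T2).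
pose proof (Rmax_l T3 T4); pose proof (Rmax_r T3 T4).
specialize (H1 t ltac:(lra)); specialize (H2 t ltac:(lra)).
specialize (H3 t ltac:(lra)); specialize (H4 t ltac:(lra)).
assert (Ht0 : 0 <= t) by lra.
assert (HD : sqrt (2 * D t) <= eps / 64).
{ rewrite <- (sqrt_pow2 (eps / 64)) by lra; apply sqrt_le_1_alt.
  rewrite Rminus_0_r in H4; pose proof (Rle_abs (D t)); lra. }
destruct (near t ltac:(lra)) as [al Hal].
assert (Hclose : forall u,
  let th := al + s * (2 * PI / L t * RInt (v t) 0 u) in
  norm2 (x t u - (c1 + r * cos th)) (y t u - (c2 + r * sin th)) < eps).
{ intros u th; specialize (Hal u); cbv zeta in Hal; fold th in Hal.
  assert (Hc : Rabs (cos th) <= 1) by (apply Rabs_le, COS_bound).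
  assert (Hs : Rabs (sin th) <= 1) by (apply Rabs_le, SIN_bound).
  (* Each coordinate collects three errors of size [eps / 8]: the distance to the circle of time
     [t], the displacement of its centre and the change of its radius. *)
  assert (B : forall p c c' e, Rabs e <= 1 -> Rabs (c - c') < eps / 8 ->
    Rabs (p - c - L t / (2 * PI) * e) <= 8 * sqrt (2 * D t) ->
    Rabs (p - (c' + r * e)) < 3 * (eps / 8)).
  { intros p c c' e Hep Hcc Hp.
    replace (p - (c' + r * e)) with ((p - c - L t / (2 * PI) * e) + ((c - c')
      + (/ (2 * PI) * L t - / (2 * PI) * l) * e)) by (unfold r; field; lra).
    eapply Rle_lt_trans; [apply Rabs_triang|].
    pose proof (Rabs_triang (c - c') ((/ (2 * PI) * L t - / (2 * PI) * l) * e)) as Hx.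
    rewrite (Rabs_mult _ e) in Hx.
    pose proof (Rabs_pos e).
    pose proof (Rabs_pos (/ (2 * PI) * L t - / (2 * PI) * l)). nra. }
  eapply Rle_lt_trans; [apply norm2_le_abs|].
  pose proof (B _ _ _ _ Hc H1 (proj1 Hal)).
  pose proof (B _ _ _ _ Hs H2 (proj2 Hal)). lra. }
split.
- intros u; specialize (Hclose u); cbv zeta in Hclose; set (th := al + _) in Hclose.
  change (dist2 (x t u) (y t u) c1 c2) with (norm2 (x t u - c1) (y t u - c2)).
  assert (Er : norm2 (r * cos th) (r * sin th) = r).
  { rewrite norm2_scal by lra; unfold norm2; rewrite cos2_sin2, sqrt_1; ring. }
  set (p := x t u - (c1 + r * cos th)) in *.
  set (p' := y t u - (c2 + r * sin th)) in *.
  pose proof (norm2_triangle (r * cos th) (r * sin th) p p') as N1.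
  pose proof (norm2_triangle (x t u - c1) (y t u - c2) (- p) (- p')) as N2.
  replace (r * cos th + p) with (x t u - c1) in N1 by (unfold p; ring).
  replace (r * sin th + p') with (y t u - c2) in N1 by (unfold p'; ring).
  replace (x t u - c1 + - p) with (r * cos th) in N2 by (unfold p; ring).
  replace (y t u - c2 + - p') with (r * sin th) in N2 by (unfold p'; ring).
  rewrite (norm2_eq (- p) (- p') p p') in N2 by ring.
  rewrite Er in N1, N2; apply Rabs_def1; lra.
- intros th.
  assert (pv : periodic1 (v t)).
  { intros u; unfold v; pose proof (Cu t Ht0) as C.
    now rewrite (cc_pa1 _ _ _ _ _ _ C), (cc_pb1 _ _ _ _ _ _ C). }
  (* Arc length takes every real value, so a parameter with angle exactly [th] exists; [s ^ 2 = 1]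
     solves for it in both orientations. *)
  destruct (arc_surj (v t) (fun u => v_pos t u Ht0) (kv t) pv
    (s * (th - al) / (2 * PI / L t))) as [u Hu].
  exists u; specialize (Hclose u); cbv zeta in Hclose; rewrite Hu in Hclose.
  pose proof (L_pos t Ht0).
  replace (al + s * (2 * PI / L t * (s * (th - al) / (2 * PI / L t))))
    with (al + s ^ 2 * (th - al)) in Hclose by (field; lra).
  rewrite s2 in Hclose.
  replace (al + 1 * (th - al)) with th in Hclose by ring.
  exact Hclose.
Qed.

End Aligned.

Lemma flow_converges :
  exists c1 c2 r, 0 < r /\ converges_to_circle x y c1 c2 r.
Proof.
destruct turning_orientation as [s [Hs H]]; exact (aligned_converges s Hs H).
Qed.

End GageFlow.

Theorem theorem4p1 (x0 y0 : R -> R) (x y : R -> R -> R) :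
  smooth1 x0 -> smooth1 y0 ->
  periodic1 x0 -> periodic1 y0 ->
  regular x0 y0 ->
  simple_closed x0 y0 ->
  gage_flow_global x0 y0 x y ->
  exists c1 c2 r : R, 0 < r /\ converges_to_circle x y c1 c2 r.
Proof. intros _ _ _ _ _ _ F; exact (flow_converges x0 y0 x y F). Qed.
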